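(* Let $n\ge1$, let $\bar r=(r_1,\dots,r_n)$ with $r_i>0$, $\sum_i r_i=1$, and let $r_+=\max_i r_i$, $r_-=\min_i r_i$. (1) Let $X\subset\mathbb R^n$ be the support of a locally finite Borel measure $\mu$ on $\mathbb R^n$ such that $(\Omega,\bar R_{\bar\sigma},\mu)$ satisfies a $(\tau,c_1,c_2)$-power law and is absolutely $(c_\delta,\delta)$-decaying with respect to the set $\mathcal S$ of affine hyperplanes. Then for $c>\log(c_\delta)/\delta+2d_*$, $$\dim\big(\mathbf{Bad}^{\bar r}_{\mathbb R^n}(\tfrac12e^{-(2c+l_* )})\cap X\big)\ \ge\ d_\mu(X)-\frac{\log(2)+2\log(\tfrac{c_2}{c_1})+2\tau d_*+|\log(1-c_\delta e^{2\delta d_*}e^{-\delta c})|}{(1+r_-)c}.$$ (2) If moreover $\bar r\in\mathbb Q^n_{>0}$, there exists $c_0>0$ depending only on $n$ and $\bar r$ such that for all $c>c_0$ $$\dim\big(\mathbf{Bad}^{\bar r}_{\mathbb R^n}(\tfrac12e^{-(2c+l_*+d_* )})\big)\ \ge\ n-\frac{|\log(1-18\,c_n e^{-(1+r_-)c})|}{(1+r_-)c},$$ $$\dim\big(\mathbf{Bad}^{\bar r}_{\mathbb R^n}(e^{-c})\big)\ \le\ n-\frac{|\log(1-\tfrac18\,3^{-(n+1)(1+r_-)}e^{-(n+1)(c+u_c)})|}{(1+r_+)(c+u_c+2d_* )}.$$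
   Context: $\dim$ is Hausdorff dimension. For $\epsilon>0$, $\mathbf{Bad}^{\bar r}_{\mathbb R^n}(\epsilon)$ is the set of $\bar x=(x_1,\dots,x_n)\in\mathbb R^n$ such that for every $q\in\mathbb N$ and $\bar p\in\mathbb Z^n$ there is some $i\in\{1,\dots,n\}$ with $|x_i-\frac{p_i}{q}|\ge\epsilon^{1+r_i}/q^{1+r_i}$. $\bar\sigma=(1+r_1,\dots,1+r_n)$ and, for $(\bar x,t)\in\mathbb R^n\times\mathbb R$, $\bar R_{\bar\sigma}(\bar x,t)=\prod_{i=1}^n[x_i-e^{-(1+r_i)t},x_i+e^{-(1+r_i)t}]$. $\Omega=X\times\mathbb R$. For $Y\subset\mathbb R^n$, $\mathcal N(Y,t)=\bigcup_{y\in Y}\bar R_{\bar\sigma}(y,t)$. $(\tau,c_1,c_2)$-power law ($\tau>0$, $c_2\ge c_1>0$): $c_1e^{-\tau t}\le\mu(\bar R_{\bar\sigma}(x,t))\le c_2e^{-\tau t}$ for all $(x,t)\in X\times\mathbb R$. Absolutely $(c_\delta,\delta)$-decaying with respect to $\mathcal S$: $\mu(\bar R_{\bar\sigma}(x,t)\cap\mathcal N(S,t+s))\le c_\delta e^{-\delta s}\mu(\bar R_{\bar\sigma}(x,t))$ for all $(x,t)\in X\times\mathbb R$, $S\in\mathcal S$, $s\ge0$. $c_n>0$ is a constant such that Lebesgue measure on $\mathbb R^n$ is absolutely $(c_n,1+r_-)$-decaying with respect to $\mathcal S$ (such a constant is known to exist). $d_\mu(X)=\inf_{x\in X}\liminf_{r\to0}\frac{\log\mu(B(x,r))}{\log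 r}$. Constants: $d_*=\frac{\log 3}{1+r_-}$, $l_*=\frac{\log(n!)}{n+1}+\frac{n}{n+1}\log2+\frac{\log3}{1+r_-}$, $u_c=\frac{1}{r_-}\big(c+2(1+r_+)\log2\big)$. *)

(* Defs.v *)
From HB Require Import structures.
From mathcomp Require Import all_boot all_order all_algebra.
From mathcomp Require Import all_classical all_reals all_analysis.

Set Implicit Arguments.
Unset Strict Implicit.
Unset Printing Implicit Defensive.

Import Order.TTheory GRing.Theory Num.Theory.
Import numFieldNormedType.Exports.

Local Open Scope classical_set_scope.
Local Open Scope ring_scope.

(* The canonical norm of 'rV[R]_n is the max norm; the metric notions below
   (diameter, balls) are stated for the Euclidean distance. *)
Definition euclid_dist (R : realType) (n : nat) (x y : 'rV[R]_n) : R :=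
  Num.sqrt (\sum_(i < n) (x 0 i - y 0 i) ^+ 2).

Definition euclid_ball (R : realType) (n : nat) (x : 'rV[R]_n) (rho : R) :
    set 'rV[R]_n :=
  [set y | euclid_dist x y <= rho].

(* The maximum with 0 gives the empty set diameter 0 instead of -oo. *)
Definition ediam (R : realType) (n : nat) (A : set 'rV[R]_n) : \bar R :=
  maxe 0%E (ereal_sup [set (euclid_dist x.1 x.2)%:E | x in A `*` A]).

Definition hausdorff_content (R : realType) (n : nat) (s d : R)
    (A : set 'rV[R]_n) : \bar R :=
  ereal_inf [set (\sum_(0 <= k <oo) poweR (ediam (U k)) s)%E
            | U in [set U : nat -> set 'rV[R]_n |
                     A `<=` \bigcup_k U k /\
                     forall k, (ediam (U k) <= d%:E)%E]].

Definition hausdorff_measure (R : realType) (n : nat) (s : R)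
    (A : set 'rV[R]_n) : \bar R :=
  ereal_sup [set hausdorff_content s d A | d in [set d : R | 0 < d]].

(* Only s > 0 is considered, so that the value of 0 to the power 0 is
   irrelevant; this does not change the infimum. *)
Definition hausdorff_dim (R : realType) (n : nat) (A : set 'rV[R]_n) : \bar R :=
  ereal_inf [set s%:E | s in [set s : R | 0 < s /\
                                hausdorff_measure s A = 0%E]].

Definition borelRn (R : realType) (n : nat) :=
  g_sigma_algebraType (@open 'rV[R]_n).

(* Lebesgue measure as the n-fold product of the Lebesgue measure of R, written
   as an iterated integral over sections (as in product_measure1). It is meant
   for Borel sets only. *)
Fixpoint lebesgueRn (R : realType) (n : nat) : set 'rV[R]_n -> \bar R :=
  match n with
  | 0 => fun A => ((\1_A (0 : 'rV[R]_0)) : R)%:E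
  | m.+1 => fun A =>
      (\int[lebesgue_measure]_(x in [set: R])
         lebesgueRn [set v : 'rV[R]_m | A (row_mx (x%:M : 'rV[R]_1) v)])%E
  end.

Definition measure_support (R : realType) (n : nat)
    (mu : set 'rV[R]_n -> \bar R) : set 'rV[R]_n :=
  [set x | forall U : set 'rV[R]_n, open U -> U x -> (0 < mu U)%E].

Definition locally_finite (R : realType) (n : nat)
    (mu : set 'rV[R]_n -> \bar R) : Prop :=
  forall x : 'rV[R]_n, exists U : set 'rV[R]_n,
    [/\ open U, U x & (mu U < +oo)%E].

Definition lower_pointwise_dim (R : realType) (n : nat)
    (mu : set 'rV[R]_n -> \bar R) (X : set 'rV[R]_n) : \bar R :=
  ereal_inf
    [set limf_einf
           (fun rho : R => lne (mu (euclid_ball x rho)) * ((ln rho)^-1)%:E)%E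
           0^'+
    | x in X].

Section Weights.
Variables (R : realType) (n : nat) (r : 'I_n -> R).

Definition rmax : R := \big[Num.max/0]_(i < n) r i.

(* The default value 1 is harmless: positive weights of sum 1 are at most 1. *)
Definition rmin : R := \big[Num.min/1]_(i < n) r i.

Definition Bad (eps : R) : set 'rV[R]_n :=
  [set x | forall (q : nat) (p : 'I_n -> int), (0 < q)%N ->
     exists i : 'I_n,
       (eps `^ (1 + r i)) / (q%:R `^ (1 + r i)) <=
         `|x 0 i - (p i)%:~R / q%:R|].

Definition box (x : 'rV[R]_n) (t : R) : set 'rV[R]_n :=
  [set y | forall i : 'I_n,
     x 0 i - expR (- ((1 + r i) * t)) <= y 0 i <=
     x 0 i + expR (- ((1 + r i) * t))].

Definition nbhd (Y : set 'rV[R]_n) (t : R) : set 'rV[R]_n :=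
  \bigcup_(y in Y) box y t.

Definition power_law (mu : set 'rV[R]_n -> \bar R) (X : set 'rV[R]_n)
    (tau c1 c2 : R) : Prop :=
  forall (x : 'rV[R]_n) (t : R), X x ->
    ((c1 * expR (- (tau * t)))%:E <= mu (box x t) /\
     mu (box x t) <= (c2 * expR (- (tau * t)))%:E)%E.

Definition abs_decaying (mu : set 'rV[R]_n -> \bar R) (X : set 'rV[R]_n)
    (SS : set (set 'rV[R]_n)) (cd delta : R) : Prop :=
  forall (x : 'rV[R]_n) (t : R) (S : set 'rV[R]_n) (s : R),
    X x -> SS S -> 0 <= s ->
    (mu (box x t `&` nbhd S (t + s)) <=
       (cd * expR (- (delta * s)))%:E * mu (box x t))%E.

Definition d_star : R := ln 3 / (1 + rmin).

Definition l_star : R :=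
  ln (n`!)%:R / n.+1%:R + n%:R / n.+1%:R * ln 2 + ln 3 / (1 + rmin).

Definition u_const (c : R) : R := rmin^-1 * (c + 2 * (1 + rmax) * ln 2).

End Weights.

Definition affine_hyperplanes (R : realType) (n : nat) : set (set 'rV[R]_n) :=
  [set S | exists (a : 'rV[R]_n) (b : R),
     a != 0 /\ S = [set x : 'rV[R]_n | \sum_(i < n) a 0 i * x 0 i = b]].

(* Main.v *)
(* Rationals with log-denominator below t - l_star in the tripled box of scale t
   span a simplex of volume too small to be non-degenerate, so they lie on one
   affine hyperplane S (simplex lemma).  Choosing sub-boxes of scale t + c off a
   neighbourhood of S, and iterating, yields a tree whose limit points are badly
   approximable; decay bounds the mass lost at each step, and a mass distribution
   argument turns this into the lower bounds.  For Lebesgue measure and rational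
   weights r_i = a_i / b, the scales b ln m make each box an exact union of
   m^(b + a_i) slabs in direction i, so nothing is lost in packing.  For the upper
   bound, Dirichlet's theorem at a badly approximable point x of the box yields a
   rational near x whose denominator is not too small; its neighbourhood contains
   a whole tile free of badly approximable points, so each step of the cover
   discards at least one tile. *)
Require Import Defs.
From HB Require Import structures.
From mathcomp Require Import all_boot all_order all_algebra.
From mathcomp Require Import all_classical all_reals all_analysis.
From mathcomp Require Import measurable_realfun perm ring lra.

Set Implicit Arguments.
Unset Strict Implicit.
Unset Printing Implicit Defensive.

Import Order.TTheory GRing.Theory Num.Theory.
Import numFieldNormedType.Exports.

Local Open Scope classical_set_scope.
Local Open Scope ring_scope.

(** * Covers and Hausdorff dimension *)

(** Scales are logarithmic, so every constant is an additive shift of [t]. The shift [d_star] pays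
    for tripling a box, and [l_star] is the shift at which the volume bound for simplices becomes
    critical. The [2 * c] in the constant of [Bad] has two sources: the step from [t] to [t + c]
    treats denominators whose logarithm lies between [t - l_star - c] and [t - l_star], a window of
    length [c], and their neighbourhoods must be smaller than a child box, which is shorter by
    another [c]. Boxes are anisotropic. Nodes of the tree are measured by their longest side, which
    has weight [rmin], whereas the upper bound cuts boxes into cubes of the shortest side, of weight
    [rmax]; hence the different denominators in the lower and upper estimates. Exact tilings exist
    only for steps [b * ln m]. The additional [d_star] and [2 * d_star] in part (2) leave room for
    rounding the step up to such a value. *)

Lemma nneseries_pair (R : realType) (f : nat * nat -> \bar R)
    (g : nat -> nat * nat) : bijective g -> (forall p, 0 <= f p)%E ->
  (\sum_(i <oo) f (g i) = \sum_(m <oo) \sum_(j <oo) f (m, j))%E.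
Proof.
move=> bij_g f0.
rewrite (@nneseries_esumT _ (fun i => f (g i))) //.
rewrite (@nneseries_esumT _ (fun m => \sum_(j <oo) f (m, j))%E); last first.
  by move=> m; exact: nneseries_ge0.
transitivity (\esum_(m in [set: nat]) \esum_(j in [set: nat]) f (m, j))%E; last first.
  by apply: eq_esum => m _; rewrite -(@nneseries_esumT _ (fun j => f (m, j))).
rewrite (@esum_esum R _ _ setT (fun=> setT) (fun m j => f (m, j))) //.
rewrite (@reindex_esum _ _ _ setT (setT `*`` fun=> setT) g); last first.
  rewrite (_ : setT `*`` _ = setT) ?setTT_bijective //.
  by apply/seteqP; split.
by apply: eq_esum => i _; case: (g i).
Qed.

Lemma bijective_nat2 : {g : nat -> nat * nat | bijective g}.
Proof.
apply: cid.
have /card_esym/ppcard_eqP[f] := card_nat2.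
by exists f; rewrite -setTT_bijective; exact: bij.
Qed.

Lemma ediam_ge0 (R : realType) (n : nat) (A : set 'rV[R]_n) : (0 <= ediam A)%E.
Proof. by rewrite /ediam le_max lexx. Qed.

Lemma ediam_le (R : realType) (n : nat) (A : set 'rV[R]_n) (d : R) : 0 <= d ->
  (forall x y, A x -> A y -> euclid_dist x y <= d) -> (ediam A <= d%:E)%E.
Proof.
move=> d0 H; rewrite /ediam ge_max lee_fin d0 /=.
apply: ge_ereal_sup => _ [[x y] [/= Ax Ay] <-].
by rewrite lee_fin; exact: H.
Qed.

Lemma ediam_ge (R : realType) (n : nat) (A : set 'rV[R]_n) x y : A x -> A y ->
  ((euclid_dist x y)%:E <= ediam A)%E.
Proof.
move=> Ax Ay; rewrite /ediam le_max; apply/orP; right.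
by apply: ereal_sup_ubound; exists (x, y).
Qed.

Lemma hausdorff_content_ge0 (R : realType) (n : nat) (s d : R)
  (A : set 'rV[R]_n) : (0 <= hausdorff_content s d A)%E.
Proof.
apply: le_ereal_inf_tmp => _ [U _ <-].
by apply: nneseries_ge0 => k _ _; exact: poweR_ge0.
Qed.

Lemma hausdorff_content_null (R : realType) (n : nat) (s d : R)
  (A : set 'rV[R]_n) :
  (forall e : R, 0 < e -> exists U : nat -> set 'rV[R]_n,
     [/\ A `<=` \bigcup_k U k, (forall k, (ediam (U k) <= d%:E)%E) &
         (\sum_(k <oo) poweR (ediam (U k)) s <= e%:E)%E]) ->
  hausdorff_content s d A = 0%E.
Proof.
move=> H; apply/eqP; rewrite eq_le hausdorff_content_ge0 andbT.
apply/lee_addgt0Pr => e e0; rewrite add0e.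
have [U [AU dU sU]] := H e e0.
by apply: le_trans sU; apply: ereal_inf_lbound; exists U.
Qed.

Lemma hausdorff_measure_null (R : realType) (n : nat) (s : R)
  (A : set 'rV[R]_n) :
  (forall d, 0 < d -> hausdorff_content s d A = 0%E) ->
  hausdorff_measure s A = 0%E.
Proof.
move=> H; apply/eqP; rewrite eq_le; apply/andP; split.
  by apply: ge_ereal_sup => _ [d d0 <-]; rewrite H.
rewrite -(H 1 ltr01); apply: ereal_sup_ubound; exists 1 => //=.
Qed.

Lemma hausdorff_measure_null_content (R : realType) (n : nat) (s d : R)
  (A B : set 'rV[R]_n) : A `<=` B -> hausdorff_measure s B = 0%E -> 0 < d ->
  hausdorff_content s d A = 0%E.
Proof.
move=> AB HB d0; apply/eqP; rewrite eq_le hausdorff_content_ge0 andbT.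
rewrite -HB; apply: (@le_trans _ _ (hausdorff_content s d B)).
  apply: le_ereal_inf => _ [U [BU dU] <-]; exists U => //; split => //.
  exact: subset_trans BU.
by apply: ereal_sup_ubound; exists d.
Qed.

Lemma eseries_halves (R : realType) (e : R) : 0 <= e ->
  (\sum_(i <oo) (e / (2 ^ i.+1)%:R)%:E <= e%:E)%E.
Proof.
move=> e0; have := @epsilon_trick R (fun=> 0%E) e xpredT (fun=> lexx _) e0.
rewrite [X in (_ <= X + _)%E -> _]eseries0 // add0e => H; apply: le_trans H.
by apply: lee_nneseries => i //=; [rewrite lee_fin divr_ge0|rewrite add0e].
Qed.

(* The label [lab i] records which of the sets the [i]-th piece covers. *)
Lemma null_countable_cover (R : realType) (n : nat) (s d e : R) (h : nat -> R)
    (A : nat -> set 'rV[R]_n) : 0 < e -> (forall m, 0 < h m) ->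
  (forall m, hausdorff_content s d (A m) = 0%E) ->
  exists (U : nat -> set 'rV[R]_n) (lab : nat -> nat),
    [/\ forall m x, A m x -> exists2 i, lab i = m & U i x,
        forall i, (ediam (U i) <= d%:E)%E,
        forall i, (poweR (ediam (U i)) s <= (h (lab i))%:E)%E &
        (\sum_(i <oo) poweR (ediam (U i)) s <= e%:E)%E].
Proof.
move=> e0 h0 A0.
have /choice[V HV] m : exists V : nat -> set 'rV[R]_n,
    [/\ A m `<=` \bigcup_k V k, (forall k, (ediam (V k) <= d%:E)%E),
        (forall k, (poweR (ediam (V k)) s <= (h m)%:E)%E) &
        (\sum_(k <oo) poweR (ediam (V k)) s <= (e / (2 ^ m.+1)%:R)%:E)%E].
  (* One cover of cost below the minimum serves both bounds: a term is at most the sum, and the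
     costs [e / 2 ^ m.+1] add up to at most [e]. *)
  have em : (0%E < (Num.min (h m) (e / (2 ^ m.+1)%:R))%:E)%E.
    by rewrite lte_fin lt_min h0 divr_gt0 // ltr0n expn_gt0.
  have := em; rewrite -[X in (X < _)%E -> _](A0 m) => {em}.
  move=> /ereal_inf_lt[_ [V [AV dV] <-] /ltW le].
  exists V; split => //.
    move=> k; apply: (@le_trans _ _ (\sum_(k <oo) poweR (ediam (V k)) s)%E).
      rewrite (@nneseriesD1 _ _ k xpredT) //; last by move=> j _; exact: poweR_ge0.
      by rewrite leeDl // nneseries_ge0 // => j _ _; exact: poweR_ge0.
    by apply: le_trans le _; rewrite lee_fin ge_min lexx.
  by apply: le_trans le _; rewrite lee_fin ge_min lexx orbT.
have [g bg] := bijective_nat2.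
exists (fun i => V (g i).1 (g i).2), (fun i => (g i).1); split.
- move=> m x Ax; have [k _ Vx] : (\bigcup_k V m k) x by case: (HV m) => + _ _ _; exact.
  have [g' _ gK] := bg.
  by exists (g' (m, k)); rewrite gK.
- by move=> i; case: (HV (g i).1).
- by move=> i; case: (HV (g i).1).
- rewrite (@nneseries_pair _ (fun p => poweR (ediam (V p.1 p.2)) s) g) //=; last first.
    by move=> p; exact: poweR_ge0.
  apply: le_trans (eseries_halves (ltW e0)).
  apply: lee_nneseries => m // _.
    by move=> _; apply: nneseries_ge0 => j _ _; exact: poweR_ge0.
  by case: (HV m).
Qed.

Lemma hausdorff_content_bigcup_null (R : realType) (n : nat) (s d : R)
    (A : nat -> set 'rV[R]_n) :
  (forall m, hausdorff_content s d (A m) = 0%E) ->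
  hausdorff_content s d (\bigcup_m A m) = 0%E.
Proof.
move=> A0; apply: hausdorff_content_null => e e0.
have [U [lab [cov dU _ sU]]] := null_countable_cover e0 (fun=> ltr01) A0.
exists U; split => // x [m _ /cov[i _ Ux]].
by exists i.
Qed.

Lemma euclid_dist_ge0 (R : realType) (n : nat) (x y : 'rV[R]_n) :
  0 <= euclid_dist x y.
Proof. exact: sqrtr_ge0. Qed.

Lemma euclid_dist_coord (R : realType) (n : nat) (x y : 'rV[R]_n) i :
  `|x 0 i - y 0 i| <= euclid_dist x y.
Proof.
rewrite -sqrtr_sqr ler_sqrt; last by apply: sumr_ge0 => j _; exact: sqr_ge0.
by rewrite (bigD1 i) //= lerDl sumr_ge0 // => j _; exact: sqr_ge0.
Qed.

Lemma euclid_dist_le (R : realType) (n : nat) (x y : 'rV[R]_n) (d : R) :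
  0 <= d -> (forall i, `|x 0 i - y 0 i| <= d) ->
  euclid_dist x y <= n%:R * d.
Proof.
move=> d0 H; have nd0 : 0 <= n%:R * d by rewrite mulr_ge0.
rewrite -(ger0_norm nd0) -sqrtr_sqr ler_sqrt ?sqr_ge0 //.
apply: (@le_trans _ _ (\sum_(i < n) d ^+ 2)).
  apply: ler_sum => i _.
  by rewrite -[X in X <= _]real_normK ?num_real // lerXn2r ?nnegrE.
rewrite sumr_const card_ord exprMn -[X in X <= _]mulr_natl ler_wpM2r ?sqr_ge0 //.
rewrite expr2 -natrM ler_nat; case: n {nd0 x y H} => // n.
by rewrite leq_pmulr.
Qed.

(* Replaces the triangle inequality: (a + b)^2 <= 2 a^2 + 2 b^2. *)
Lemma euclid_dist_double (R : realType) (n : nat) (x y z : 'rV[R]_n) (d : R) :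
  euclid_dist x y <= d -> euclid_dist y z <= d -> euclid_dist x z <= 2 * d.
Proof.
move=> xy yz; have d0 : 0 <= d by exact: le_trans (euclid_dist_ge0 x y) xy.
have sq (u v : 'rV[R]_n) : euclid_dist u v <= d ->
    \sum_(i < n) (u 0 i - v 0 i) ^+ 2 <= d ^+ 2.
  by rewrite /euclid_dist -{1}(ger0_norm d0) -sqrtr_sqr ler_sqrt // sqr_ge0.
have d20 : 0 <= 2 * d by rewrite mulr_ge0.
rewrite /euclid_dist -(ger0_norm d20) -sqrtr_sqr ler_sqrt ?sqr_ge0 //.
apply: (@le_trans _ _ (2 * \sum_(i < n) (x 0 i - y 0 i) ^+ 2 +
                       2 * \sum_(i < n) (y 0 i - z 0 i) ^+ 2)).
  rewrite !mulr_sumr -big_split /=; apply: ler_sum => i _.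
  by have := sqr_ge0 (x 0 i - 2 * y 0 i + z 0 i); nra.
by have := sq _ _ xy; have := sq _ _ yz; nra.
Qed.

(** Pigeonhole: if [E] were at least [W] at every child, summing would give the same at the parent.
    So the strict inequality passes to some child, and choice follows it forever. *)
Lemma greedy_branch (R : realType) (T : eqType) (good : nat -> T -> Prop)
    (step : nat -> T -> T -> Prop) (E W : nat -> T -> \bar R) (x0 : T) :
  good 0%N x0 -> (E 0%N x0 < W 0%N x0)%E ->
  (forall k x, good k x -> exists s : seq T,
     [/\ forall x', x' \in s -> good k.+1 x' /\ step k x x',
         (W k x <= \sum_(x' <- s) W k.+1 x')%E &
         (\sum_(x' <- s) E k.+1 x' <= E k x)%E]) ->
  exists u : nat -> T, forall k,
    [/\ good k (u k), step k (u k) (u k.+1) & (E k (u k) < W k (u k))%E].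
Proof.
move=> g0 EW0 H.
have /choice[f Hf] (p : nat * T) : exists x', good p.1 p.2 /\ (E p.1 p.2 < W p.1 p.2)%E ->
    [/\ good p.1.+1 x', step p.1 p.2 x' & (E p.1.+1 x' < W p.1.+1 x')%E].
  case: p => k x /=.
  have [[gx EW]|] := pselect (good k x /\ (E k x < W k x)%E); last by exists x0.
  have [s [Hs Ws Es]] := H k x gx.
  have [[x' [x's lt]]|nex] :=
      pselect (exists x', x' \in s /\ (E k.+1 x' < W k.+1 x')%E).
    by exists x' => _; have [] := Hs _ x's.
  exfalso; move: (lt_le_trans (le_lt_trans Es EW) Ws); rewrite ltNge => /negP; apply.
  rewrite big_seq [X in (_ <= X)%E]big_seq; apply: lee_sum => x' x's.
  by rewrite leNgt; apply/negP => lt; apply: nex; exists x'.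
pose u := fix u k := if k is k'.+1 then f (k', u k') else x0.
have Hu k : good k (u k) /\ (E k (u k) < W k (u k))%E.
  by elim: k => // k [gk Ek]; have [] := Hf (k, u k) (conj gk Ek).
by exists u => k; have [gk Ek] := Hu k; have [] := Hf (k, u k) (conj gk Ek).
Qed.

(** Take the least level of diameter at most [rho]: failure of the level before it bounds
    [expR (kap * k)]. The maximum with 1 serves level 0, which has no predecessor. *)
Lemma exists_level (R : realType) (D kap rho : R) :
  0 < D -> 0 < kap -> 0 < rho -> rho <= 1 ->
  exists k : nat, D * expR (- (kap * k%:R)) <= rho /\
    expR (kap * k%:R) <= Num.max 1 (D * expR kap) / rho.
Proof.
move=> D0 kap0 r0 r1.
have ex : exists k : nat, D * expR (- (kap * k%:R)) <= rho.
  exists (Num.truncn (ln (D / rho) / kap)).+1.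
  have := truncnS_gt (ln (D / rho) / kap).
  rewrite ltr_pdivrMr // => /ltW.
  rewrite -(ler_expR (ln (D / rho))) lnK ?posrE ?divr_gt0 // => H.
  by rewrite expRN ler_pdivrMr ?expR_gt0 // -ler_pdivrMl // mulrC [kap * _]mulrC.
exists (ex_minn ex); case: ex_minnP => [[|k]] Hk min; split => //.
  by rewrite mulr0 expR0 ler_pdivlMr // mul1r le_max r1.
have : rho < D * expR (- (kap * k%:R)).
  by rewrite ltNge; apply/negP => /min; rewrite ltnn.
rewrite expRN ltr_pdivlMr ?expR_gt0 // => /ltW lt.
rewrite ler_pdivlMr // -natr1 mulrDr mulr1 expRD.
have E0 := expR_gt0 kap.
rewrite le_max; apply/orP; right.
have := ler_wpM2r (ltW E0) lt.
by apply: le_trans; rewrite mulrC mulrA.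
Qed.

(* A mass distribution principle that constructs no measure on the limit set.
   Given a cheap cover, [E k x] is the total mass [M] that the covering balls,
   weighted by [expR (L * level)], carry inside the node [x]; a branch along
   which [E k x < W k x] avoids every ball, since [W] is dominated by the term of
   a ball containing the node. *)
Lemma hausdorff_dim_ge (R : realType) (n : nat) (A : set 'rV[R]_n)
    (good : nat -> 'rV[R]_n -> Prop) (node : nat -> 'rV[R]_n -> set 'rV[R]_n)
    (W : nat -> 'rV[R]_n -> \bar R) (M : 'rV[R]_n -> R -> nat -> 'rV[R]_n -> \bar R)
    (x0 : 'rV[R]_n) (D L kap d w : R) :
  0 < D -> 0 <= L -> 0 < kap -> 0 < w ->
  (forall k x y z, node k x y -> node k x z ->
     euclid_dist y z <= D * expR (- (kap * k%:R))) ->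
  (forall y rho k x, 0 <= M y rho k x)%E ->
  good 0%N x0 -> (w%:E <= W 0%N x0)%E ->
  (forall k x, good k x -> exists s : seq 'rV[R]_n,
     [/\ forall x', x' \in s -> good k.+1 x' /\ node k.+1 x' `<=` node k x,
         (W k x <= \sum_(x' <- s) W k.+1 x')%E &
         forall y rho, (\sum_(x' <- s) M y rho k.+1 x' <= M y rho k x)%E]) ->
  (forall k x y rho, good k x -> node k x `<=` euclid_ball y rho ->
     (W k x <= (expR (L * k%:R))%:E * M y rho k x)%E) ->
  (forall y, A y -> forall d', d' < d -> exists rho0, 0 < rho0 /\
     forall rho, 0 < rho -> rho < rho0 -> (M y rho 0%N x0 <= (rho `^ d')%:E)%E) ->
  (forall u, (forall k, good k (u k)) ->
     (forall k, node k.+1 (u k.+1) `<=` node k (u k)) ->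
     exists z, A z /\ forall k, node k (u k) z) ->
  ((d - L / kap)%:E <= hausdorff_dim A)%E.
Proof.
move=> D0 L0 kap0 w0 diam M0 g0 wW child incl loc lim.
apply: le_ereal_inf_tmp => _ [s [s0 HA] <-]; rewrite lee_fin leNgt; apply/negP => sd.
have [d' sd' d'd] : exists2 d', s + L / kap < d' & d' < d.
  exists ((s + L / kap + d) / 2); lra.
have d'0 : 0 < d' by apply: lt_trans sd'; rewrite ltr_wpDr // divr_ge0 // ltW.
(* Countably many pieces make the threshold of the local mass bound uniform. *)
pose inA m : set 'rV[R]_n := [set x | A x /\ forall rho, 0 < rho -> rho < m.+1%:R^-1 ->
   (M x rho 0%N x0 <= (rho `^ d')%:E)%E].
(* [C * rho ^ s] bounds the root term of a ball of radius [2 * rho]: the level weight costs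
   [rho ^ (- L / kap)], the mass is at most [(2 * rho) ^ d'], and [d' - L / kap > s] with
   [rho <= 1]. *)
pose C := Num.max 1 (D * expR kap) `^ (L / kap) * 2 `^ d'.
have C0 : 0 < C.
  by rewrite mulr_gt0 // powR_gt0 // lt_max ltr01.
(* Diameters and padding each cost at most [e], so the root total is at most
   [C * (e + e) = w / 2]. *)
pose e := w / (4 * C).
have e0 : 0 < e by rewrite divr_gt0 // mulr_gt0.
(* From [rho ^ s <= 2 * h m] follows [2 * rho < 1 / (m + 1)], the range in which [inA m] controls
   the mass. *)
pose h m : R := (4^-1 * m.+1%:R^-1) `^ s / 2.
have h0 m : 0 < h m by rewrite divr_gt0 // powR_gt0 // mulr_gt0 // invr_gt0.
have A0 m : hausdorff_content s 1 (inA m) = 0%E.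
  by apply: hausdorff_measure_null_content HA _ => // x [].
have [U [lab [cov dU hU sU]]] := null_countable_cover e0 h0 A0.
pose Di i : R := fine (ediam (U i)).
have DiE i : ediam (U i) = (Di i)%:E.
  rewrite /Di fineK // ge0_fin_numE ?ediam_ge0 //.
  by apply: le_lt_trans (dU i) _; rewrite ltry.
have Di0 i : 0 <= Di i by rewrite -lee_fin -DiE ediam_ge0.
(* Padding that makes every radius positive, even for a piece of diameter 0. *)
pose eta i : R := Num.min (h (lab i)) (e / (2 ^ i.+1)%:R).
have eta0 i : 0 < eta i.
  by rewrite lt_min h0 divr_gt0 // ltr0n expn_gt0.
pose rho i : R := (Di i `^ s + eta i) `^ s^-1.
have Ds0 i : 0 < Di i `^ s + eta i by rewrite ltr_wpDl // powR_ge0.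
have rho0 i : 0 < rho i by exact: powR_gt0.
have rhos i : rho i `^ s = Di i `^ s + eta i.
  by rewrite -powRrM mulVf ?gt_eqF // powRr1 // ltW.
have s'0 : 0 <= s^-1 by rewrite invr_ge0 ltW.
have Drho i : Di i <= rho i.
  have -> : Di i = (Di i `^ s) `^ s^-1 by rewrite -powRrM mulfV ?gt_eqF // powRr1.
  apply: ge0_ler_powR => //; first by rewrite nnegrE powR_ge0.
    by rewrite nnegrE ltW.
  by rewrite lerDl ltW.
have rhoh i : rho i <= 4^-1 * (lab i).+1%:R^-1.
  have q0 : 0 <= 4^-1 * (lab i).+1%:R^-1 :> R by rewrite mulr_ge0 // invr_ge0.
  have -> : 4^-1 * (lab i).+1%:R^-1 = (2 * h (lab i)) `^ s^-1 :> R.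
    by rewrite /h mulrCA mulfV // mulr1 -powRrM mulfV ?gt_eqF // powRr1.
  apply: ge0_ler_powR => //; first by rewrite nnegrE ltW.
    by rewrite nnegrE ltW // mulr_gt0.
  rewrite mulr_natl mulr2n lerD //; last by rewrite ge_min lexx.
  by have := hU i; rewrite DiE poweR_EFin lee_fin.
have rho4 i : rho i <= 4^-1.
  apply: le_trans (rhoh i) _; rewrite ler_piMr //.
  by rewrite invf_le1 // ler1n.
have /choice[lev Hlev] i := @exists_level R D kap (rho i) D0 kap0 (rho0 i)
  (le_trans (rho4 i) (ltac:(lra) : 4^-1 <= 1 :> R)).
(* The doubled radius lets the ball contain every node of level [lev i] that meets [U i]. A piece
   without a point of [inA (lab i)] contributes nothing. *)
pose F i k x : \bar R := if pselect (exists y, U i y /\ inA (lab i) y) is left ex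
  then ((expR (L * (lev i)%:R))%:E * M (projT1 (cid ex)) (2 * rho i)%R k x)%E else 0%E.
have F0 i k x : (0 <= F i k x)%E.
  by rewrite /F; case: pselect => // ex; rewrite mule_ge0 // lee_fin expR_ge0.
pose E k x := (\sum_(i <oo) F i k x)%E.
have FE i k x : (F i k x <= E k x)%E.
  rewrite /E (@nneseriesD1 _ _ i xpredT) //.
  by rewrite leeDl // nneseries_ge0.
have EW : (E 0%N x0 < W 0%N x0)%E.
  apply: lt_le_trans wW.
  apply: (@le_lt_trans _ _ (\sum_(i <oo) (C * (Di i `^ s + eta i))%:E)%E).
    apply: lee_nneseries => i // _.
    rewrite /F; case: pselect => [ex|_]; last first.
      by rewrite lee_fin mulr_ge0 // ltW.
    case: cid => y /= [Uy [Ay Hy]].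
    have rl : 2 * rho i < (lab i).+1%:R^-1.
      have := rhoh i; have : (0:R) < (lab i).+1%:R^-1 by rewrite invr_gt0.
      by move: (_^-1) => t; lra.
    have := Hy _ (mulr_gt0 (ltr0n R 2) (rho0 i)) rl.
    move=> HM; apply: (le_trans (lee_wpmul2l _ HM)); first by rewrite lee_fin expR_ge0.
    rewrite -EFinM lee_fin -rhos /C.
    have [_ Hexp] := Hlev i.
    have -> : expR (L * (lev i)%:R) = (expR (kap * (lev i)%:R)) `^ (L / kap).
      by rewrite -expRM; congr expR; field; rewrite gt_eqF.
    have m0 : 0 <= Num.max 1 (D * expR kap) by rewrite le_max ler01.
    apply: (@le_trans _ _ ((Num.max 1 (D * expR kap) / rho i) `^ (L / kap) * (2 * rho i) `^ d')).
      apply: ler_wpM2r; first exact: powR_ge0.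
      apply: ge0_ler_powR => //; rewrite ?nnegrE ?expR_ge0 //.
        by rewrite divr_ge0 // ltW.
      by rewrite divr_ge0 // ltW.
    have ri0 := ltW (rho0 i).
    have rV0 : 0 <= (rho i)^-1 by rewrite invr_ge0.
    rewrite powRM // powRM //.
    rewrite -!mulrA ler_wpM2l ?powR_ge0 // mulrCA ler_wpM2l ?powR_ge0 //.
    rewrite -powR_inv1 // -powRrM -powRD; last first.
      by rewrite (gt_eqF (rho0 i)) implybT.
    rewrite ger_powR ?rho0 ?(le_trans (rho4 i)) //; lra.
  have -> : (\sum_(i <oo) (C * (Di i `^ s + eta i))%:E =
          C%:E * (\sum_(i <oo) poweR (ediam (U i)) s + \sum_(i <oo) (eta i)%:E))%E.
    rewrite -nneseriesD; last 2 first.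
      by move=> i _ _; exact: poweR_ge0.
      by move=> i _ _; rewrite lee_fin ltW.
    rewrite -nneseriesZl; last by move=> i _; rewrite adde_ge0 ?poweR_ge0 // lee_fin ltW.
    by apply: eq_eseriesr => i _; rewrite DiE poweR_EFin -EFinD -EFinM.
  have eta_le : (\sum_(i <oo) (eta i)%:E <= e%:E)%E.
    apply: le_trans (eseries_halves (ltW e0)).
    apply: lee_nneseries => i // _; first by rewrite lee_fin ltW.
    by rewrite lee_fin ge_min lexx orbT.
  apply: (@le_lt_trans _ _ (C%:E * (e%:E + e%:E))%E).
    by apply: lee_wpmul2l; [rewrite lee_fin ltW | exact: leeD].
  rewrite -EFinD -EFinM lte_fin /e.
  have -> : C * (w / (4 * C) + w / (4 * C)) = w / 2 by field; rewrite gt_eqF.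
  lra.
have [u Hu] := @greedy_branch R _ good (fun k x x' => node k.+1 x' `<=` node k x) E W x0
   g0 EW (fun k x gx => ltac:(
     have [t [Ht Wt Mt]] := child k x gx; exists t; split => //;
     rewrite /E -nneseries_sum; [|by move=> *; exact: F0];
     apply: lee_nneseries => i *; [exact: sume_ge0|];
     rewrite /F; case: pselect => [ex|_]; last (by rewrite big1);
     rewrite -ge0_sume_distrr; [|by move=> *; exact: M0];
     rewrite lee_wpmul2l ?lee_fin ?expR_ge0 //; exact: Mt)).
have [z [Az Hz]] := lim u (fun k => let: And3 g _ _ := Hu k in g)
   (fun k => let: And3 _ g _ := Hu k in g).
have [rz [rz0 Hrz]] := loc z Az d' d'd.
have [m Hm] : exists m, inA m z.
  exists (Num.truncn rz^-1); split => // r' r'0 r'm; apply: Hrz => //.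
  apply: lt_trans r'm _; rewrite invf_plt ?posrE //.
  exact: truncnS_gt.
have [i labi Uz] := cov m z Hm.
(* The node of level [lev i] contains [z] and has diameter at most [rho i], so it lies in the ball
   around [y]; then [W <= F i <= E] contradicts the choice of the branch. *)
have [gi _] := Hu (lev i); rewrite ltNge => /negP; apply.
apply: le_trans (FE i _ _).
rewrite /F; case: pselect => [ex|nex]; last first.
  by exfalso; apply: nex; exists z; rewrite labi.
case: cid => y /= [Uy _].
apply: incl => // v Hv; rewrite /euclid_ball /=.
have zy : euclid_dist y z <= rho i.
  apply: le_trans (Drho i); rewrite -lee_fin -DiE; exact: ediam_ge.
apply: (euclid_dist_double zy).
by apply: le_trans (diam _ _ _ _ (Hz _) Hv) _; have [] := Hlev i.
Qed.

(** * Weighted boxes and the simplex lemma *)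

Section WeightBounds.
Variables (R : realType) (n : nat) (r : 'I_n -> R).
Hypotheses (n_ge1 : (1 <= n)%N) (r_gt0 : forall i, 0 < r i)
  (r_sum1 : \sum_(i < n) r i = 1).

Definition radius (i : 'I_n) (t : R) : R := expR (- ((1 + r i) * t)).

Lemma radius_gt0 i t : 0 < radius i t.
Proof. exact: expR_gt0. Qed.

Lemma radiusD i s t : radius i (s + t) = radius i s * radius i t.
Proof. by rewrite /radius -expRD; congr expR; ring. Qed.

Lemma radius_le i s t : s <= t -> radius i t <= radius i s.
Proof.
by move=> st; rewrite ler_expR lerN2 ler_wpM2l // addr_ge0 // ltW.
Qed.

Lemma boxP x t y : box r x t y <-> forall i, `|y 0 i - x 0 i| <= radius i t.
Proof.
split=> H i; have := H i; rewrite /radius ler_norml.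
  by move=> /andP[? ?]; apply/andP; split; lra.
by move=> /andP[? ?]; apply/andP; split; lra.
Qed.

Lemma rmin_le i : rmin r <= r i.
Proof. exact: bigmin_le_cond. Qed.

Lemma rmin_gt0 : 0 < rmin r.
Proof. by rewrite /rmin; apply: lt_bigmin => // i _. Qed.

Lemma rmin_le1 : rmin r <= 1.
Proof. exact: bigmin_le_id. Qed.

Lemma rmin_attained : exists i, rmin r = r i.
Proof.
have i0 : 'I_n by exact: Ordinal n_ge1.
have r1 i : r i <= 1.
  by rewrite -r_sum1 (bigD1 i) //= lerDl sumr_ge0 // => j _; exact: ltW.
have [i _ Hi] := @eq_bigmin _ _ _ 1 i0 xpredT r isT (fun i _ => r1 i).
by exists i.
Qed.

Lemma rmax_ge i : r i <= rmax r.
Proof. exact: le_bigmax. Qed.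

Lemma rmax_attained : exists i, rmax r = r i.
Proof.
have i0 : 'I_n by exact: Ordinal n_ge1.
have [i _ Hi] := @eq_bigmax _ _ _ 0 i0 xpredT r isT (fun i _ => ltW (r_gt0 i)).
by exists i.
Qed.

Lemma d_star_gt0 : 0 < d_star r.
Proof. by rewrite divr_gt0 ?addr_gt0 ?rmin_gt0 // ln_gt0 // ltr1n. Qed.

(** Radii shrink slowest in the direction of smallest weight, and [d_star] is the shift at which
    that radius is exactly 1/3. *)
Lemma radius_d_star_le i : radius i (d_star r) <= 3^-1.
Proof.
have -> : 3^-1 = expR (- ln 3) :> R by rewrite expRN lnK // posrE.
rewrite ler_expR lerN2 /d_star mulrCA ler_pMr ?ln_gt0 ?ltr1n //.
by rewrite ler_pdivlMr ?addr_gt0 ?rmin_gt0 // mul1r lerD2l rmin_le.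
Qed.

Lemma radius_subd_star i t : 3 * radius i t <= radius i (t - d_star r).
Proof.
have := radius_d_star_le i; have -> : radius i t = radius i (t - d_star r) * radius i (d_star r).
  by rewrite -radiusD subrK.
by have := radius_gt0 i (t - d_star r); nra.
Qed.

Lemma radius_ln2_lt i : radius i (ln 2) < 2^-1.
Proof.
have -> : 2^-1 = expR (- ln 2) :> R by rewrite expRN lnK // posrE.
by rewrite ltr_expR ltrN2 ltr_pMl ?ln_gt0 ?ltr1n // ltrDl.
Qed.

Lemma prod_radius t : \prod_(i < n) radius i t = expR (- (n.+1%:R * t)).
Proof.
rewrite /radius -expR_sum; congr expR.
rewrite sumrN -mulr_suml big_split /= r_sum1 sumr_const card_ord.
by rewrite -natr1.
Qed.

Lemma powR_radius (eps q : R) i : 0 < eps -> 0 < q ->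
  eps `^ (1 + r i) / q `^ (1 + r i) = radius i (ln q - ln eps).
Proof.
move=> e0 q0; rewrite /powR !gt_eqF // /radius -expRN -expRD; congr expR; ring.
Qed.

(* For [b = - ln eps] the bound is the one in [Bad r eps], see [powR_radius]. *)
Definition away (b s : R) (x : 'rV[R]_n) (t : R) : Prop :=
  forall y, box r x t y -> forall (q : nat) (p : 'I_n -> int), (0 < q)%N ->
    ln q%:R < s -> exists i, radius i (ln q%:R + b) <= `|y 0 i - (p i)%:~R / q%:R|.

Lemma Bad_of_away (eps b : R) (z : 'rV[R]_n) : 0 < eps -> b <= - ln eps ->
  (forall k : nat, exists s x t, [/\ k%:R <= s, away b s x t & box r x t z]) ->
  Bad r eps z.
Proof.
move=> e0 b_le H q p q0.
have [s [x [t [ks aw Hz]]]] := H (Num.truncn (ln q%:R : R)).+1.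
have [i Hi] := aw z Hz q p q0 (lt_le_trans (truncnS_gt _) ks).
exists i; rewrite powR_radius ?ltr0n //; apply: le_trans Hi.
by apply: radius_le; rewrite lerD2l.
Qed.

(** Inclusion tested at two opposite corners makes the endpoints monotone in each coordinate; the
    suprema of the lower endpoints form a common point. *)
Lemma nested_boxes (u : nat -> 'rV[R]_n) (t : nat -> R) :
  (forall k, box r (u k.+1) (t k.+1) `<=` box r (u k) (t k)) ->
  exists z, forall k, box r (u k) (t k) z.
Proof.
move=> nest.
pose lo k i := u k 0 i - radius i (t k); pose hi k i := u k 0 i + radius i (t k).
have lohi k i : lo k i <= hi k i.
  by rewrite /lo /hi; have := radius_gt0 i (t k); lra.
have lo_le k i : lo k i <= lo k.+1 i.
  have /nest/boxP/(_ i) : box r (u k.+1) (t k.+1) (\row_j lo k.+1 j).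
    by apply/boxP => j; rewrite mxE /lo addrC addKr normrN ger0_norm // ltW // radius_gt0.
  by rewrite mxE ler_norml => /andP[+ _]; rewrite [lo k i]/lo; lra.
have hi_le k i : hi k.+1 i <= hi k i.
  have /nest/boxP/(_ i) : box r (u k.+1) (t k.+1) (\row_j hi k.+1 j).
    by apply/boxP => j; rewrite mxE /hi addrC addKr ger0_norm // ltW // radius_gt0.
  by rewrite mxE ler_norml => /andP[_]; rewrite [hi k i]/hi; lra.
have lom i k m : (k <= m)%N -> lo k i <= lo m i.
  by apply: (@homo_leq _ (lo^~ i) (<=%R)) => //; exact: le_trans.
have him i k m : (k <= m)%N -> hi m i <= hi k i.
  move=> km; rewrite -lerN2.
  apply: (@homo_leq _ (fun k => - hi k i) (<=%R)) => //; first exact: le_trans.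
  by move=> k'; rewrite lerN2.
have all i k m : lo k i <= hi m i.
  by apply: le_trans (lom i _ _ (leq_maxl k m)) (le_trans (lohi _ _) (him i _ _ (leq_maxr k m))).
exists (\row_i sup [set lo k i | k in [set: nat]]) => k i.
have ub m : ubound [set lo k i | k in [set: nat]] (hi m i) by move=> _ [k' _ <-].
rewrite mxE; apply/andP; split.
  by apply: ub_le_sup; [exists (hi 0%N i); exact: ub|exists k].
by apply: ge_sup; [exists (lo 0%N i); exists 0%N|exact: ub].
Qed.

End WeightBounds.

(** A largest independent family of vectors satisfying [P] has at most [n] members, so some nonzero
    [u] is orthogonal to it; by maximality its span contains all of [P]. For vectors with first
    entry 1, orthogonality to [u] is an affine equation. *)
Lemma hyperplane_of_dets (F : fieldType) (n : nat) (P : 'rV[F]_n.+1 -> Prop) :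
  (forall A : 'M[F]_n.+1, (forall i, P (row i A)) -> \det A = 0) ->
  exists2 u : 'cV[F]_n.+1, u != 0 & forall v, P v -> v *m u = 0.
Proof.
move=> H.
pose Q k := `[< exists A : 'M[F]_(k, n.+1), row_free A /\ forall i, P (row i A) >].
have Q0 : exists k, Q k.
  exists 0%N; apply/asboolP; exists 0; split; last by case.
  by rewrite /row_free mxrank0.
have Qle k : Q k -> (k <= n.+1)%N.
  by move=> /asboolP[A [/eqP rA _]]; rewrite -[k]rA rank_leq_col.
case: (ex_maxnP Q0 Qle) => k /asboolP[A [fA PA]] kmax.
have kn : (k < n.+1)%N.
  rewrite ltn_neqAle Qle ?andbT; last by apply/asboolP; exists A.
  apply/eqP => kE; subst k.
  have := H A PA; apply/eqP; rewrite -unitfE -unitmxE -row_free_unit //.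
have [w w0 wA] : exists2 w : 'rV[F]_n.+1, w != 0 & w *m A^T = 0.
  have : kermx A^T != 0.
    rewrite -mxrank_eq0 mxrank_ker mxrank_tr (eqP fA) subn_eq0 -ltnNge //.
  by move=> /rowV0Pn[w /sub_kermxP wA w0]; exists w.
exists w^T; first by rewrite trmx_eq0.
have Aw : A *m w^T = 0 by rewrite -[A]trmxK -trmx_mul wA trmx0.
move=> v Pv; have [/submxP[B ->]|nvA] := boolP (v <= A)%MS.
  by rewrite -mulmxA Aw mulmx0.
exfalso; have : Q k.+1.
  apply/asboolP; rewrite -addn1; exists (col_mx A v); split; last first.
    move=> i; case: (splitP i) => j ij.
      by rewrite (_ : i = lshift 1 j) ?rowKu //; exact/val_inj.
    rewrite (_ : i = rshift k j); last exact/val_inj.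
    by rewrite rowKd row_id // ord1.
  rewrite /row_free eqn_leq rank_leq_row /= -addsmxE.
  have : (A < A + v)%MS by rewrite ltmxE addsmxSl /= addsmx_sub submx_refl.
  by move=> /rank_ltmx; rewrite (eqP fA) addn1.
by move/kmax; rewrite ltnn.
Qed.

(** Leibniz expansion: [n!] terms, each using every column once. The bound depends on the column
    because the sides of a box differ. *)
Lemma det_le_prod (R : realDomainType) (n : nat) (A : 'M[R]_n) (h : 'I_n -> R) :
  (forall i j, `|A i j| <= h j) -> `|\det A| <= n`!%:R * \prod_j h j.
Proof.
move=> H; apply: le_trans (ler_norm_sum _ _ _) _.
rewrite -card_Sn -sum1_card natr_sum mulr_suml.
apply: ler_sum => s _; rewrite mul1r normrM normrX normrN1 expr1n mul1r normr_prod.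
rewrite [X in _ <= X](reindex_inj (@perm_inj _ s)) /=.
by apply: ler_prod => i _; rewrite normr_ge0 H.
Qed.

(** Subtract the first row from the others. Up to sign the determinant is [n!] times the volume of
    the simplex spanned by the points. *)
Lemma det_affine (R : comNzRingType) (n : nat) (v0 : 'rV[R]_n) (V : 'M[R]_n) :
  \det (block_mx 1%:M v0 (const_mx 1) V) =
  \det (\matrix_(i, j) (V i j - v0 0 j)).
Proof.
have -> : block_mx 1%:M v0 (const_mx 1) V =
    block_mx 1%:M 0 (const_mx 1) 1%:M *m
    block_mx 1%:M v0 0 (\matrix_(i, j) (V i j - v0 0 j)).
  rewrite mulmx_block !mul1mx !mulmx1 !mul0mx !addr0.
  congr (block_mx _ _ _ _).
  apply/matrixP => i j; rewrite !mxE big_ord1 !mxE; ring.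
by rewrite det_mulmx det_lblock det_ublock !det1 !mul1r.
Qed.

Section SimplexLemma.
Variables (R : realType) (n : nat) (r : 'I_n -> R).
Hypotheses (n_ge1 : (1 <= n)%N) (r_gt0 : forall i, 0 < r i)
  (r_sum1 : \sum_(i < n) r i = 1).

Definition ratpt (q : nat) (p : 'I_n -> int) : 'rV[R]_n :=
  \row_i ((p i)%:~R / q%:R).

Lemma exists_hyperplane : exists S, @affine_hyperplanes R n S.
Proof.
exists [set x : 'rV[R]_n | \sum_(i < n) (const_mx 1 : 'rV[R]_n) 0 i * x 0 i = 0].
exists (const_mx 1), 0; split => //.
by apply/eqP => /matrixP/(_ 0 (Ordinal n_ge1)); rewrite !mxE; exact/eqP/oner_neq0.
Qed.

(** Clearing the denominator of each row leaves an integer matrix, whose nonzero determinant has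
    absolute value at least 1. *)
Lemma det_ratpt_ge1 (q : 'I_n.+1 -> nat) (p : 'I_n.+1 -> 'I_n -> int)
    (A : 'M[R]_(1 + n)) :
  (forall i, row i A = row_mx 1%:M (ratpt (q i) (p i))) ->
  (forall i, (0 < q i)%N) -> \det A != 0 -> 1 <= \prod_i (q i)%:R * `|\det A|.
Proof.
move=> HA q0 dA.
pose N : 'M[int]_(1 + n) := \matrix_(i, j)
  match fintype.split j with inl _ => (q i)%:Z | inr k => p i k end.
have NE : map_mx intr N = diag_mx (\row_i (q i)%:R) *m A.
  apply/matrixP => i j; rewrite mul_diag_mx !mxE.
  have -> : A i j = row i A 0 j by rewrite mxE.
  rewrite HA mxE; case: (fintype.split j) => k; rewrite !mxE ?ord1 ?mulr1 //.
  by rewrite mulrCA mulfV ?mulr1 // pnatr_eq0 -lt0n.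
have dN : (\det N)%:~R = \prod_i (q i)%:R * \det A.
  rewrite -det_map_mx NE det_mulmx det_diag; congr (_ * _).
  by apply: eq_bigr => i _; rewrite mxE.
have q0' : 0 <= \prod_i (q i)%:R :> R by apply: prodr_ge0.
rewrite -{1}(ger0_norm q0') -normrM -dN -intr_norm ler1z.
rewrite -gtz0_ge1 normr_gt0; apply: contra_neq dA => dN0.
move/eqP: dN; rewrite dN0 mulr0z eq_sym mulf_eq0 => /orP[|/eqP //].
by rewrite gt_eqF // prodr_gt0 // => i _; rewrite ltr0n.
Qed.

(** The box of scale [t - d_star] bounds the determinant of any [n + 1] such points from above,
    their denominators bound it from below if it is nonzero, and the two bounds contradict each
    other. *)
Lemma simplex_lemma (x : 'rV[R]_n) (t : R) :
  exists2 S, @affine_hyperplanes R n S &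
    forall (q : nat) (p : 'I_n -> int), (0 < q)%N ->
      ln q%:R < t - l_star r -> box r x (t - d_star r) (ratpt q p) ->
      S (ratpt q p).
Proof.
pose P (w : 'rV[R]_(1 + n)) := exists q p, [/\ (0 < q)%N, ln q%:R < t - l_star r,
  box r x (t - d_star r) (ratpt q p) & w = row_mx 1%:M (ratpt q p)].
have [[w Pw]|noP] := pselect (exists w, P w); last first.
  have [S HS] := exists_hyperplane; exists S => // q p q0 lq bq.
  by exfalso; apply: noP; exists (row_mx 1%:M (ratpt q p)), q, p.
have dets (A : 'M[R]_(1 + n)) : (forall i, P (row i A)) -> \det A = 0.
  move=> /choice[q /choice[p HP]]; apply/eqP; apply: contraT => dA.
  have := @det_ratpt_ge1 q p A (fun i => let: And4 _ _ _ e := HP i in e)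
    (fun i => let: And4 e _ _ _ := HP i in e) dA.
  rewrite leNgt => /negP; case.
  pose i1 : 'I_(1 + n) := lshift n 0.
  pose V : 'M[R]_n := \matrix_(i, j) ratpt (q (rshift 1 i)) (p (rshift 1 i)) 0 j.
  have AE : A = block_mx 1%:M (ratpt (q i1) (p i1)) (const_mx 1) V.
    apply/row_matrixP => i; have [_ _ _ ->] := HP i; rewrite /block_mx.
    case: (splitP i) => k ik.
      have -> : i = lshift n k by exact: val_inj.
      by rewrite rowKu (ord1 k) row_id.
    have -> : i = rshift 1 k by exact: val_inj.
    rewrite rowKd row_row_mx; congr row_mx.
      by apply/rowP => j; rewrite !mxE !ord1.
    by apply/rowP => j; rewrite !mxE.
  have dle : `|\det A| <= n`!%:R * \prod_(j < n) (2 * radius r j (t - d_star r)).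
    rewrite AE det_affine; apply: det_le_prod => i j; rewrite !mxE.
    have [_ _ /boxP/(_ j) + _] := HP (rshift 1 i).
    have [_ _ /boxP/(_ j) + _] := HP i1.
    rewrite !mxE !ler_norml => /andP[? ?] /andP[? ?]; apply/andP; split; lra.
  have qlt : \prod_(i < 1 + n) (q i)%:R < expR (n.+1%:R * (t - l_star r)).
    have -> : expR (n.+1%:R * (t - l_star r)) = \prod_(i < 1 + n) expR (t - l_star r).
      by rewrite prodr_const card_ord expRM_natl.
    apply: ltr_prod; first by apply/hasP; exists i1; rewrite ?mem_index_enum.
    move=> i _; have [qi lq _ _] := HP i.
    by rewrite ler0n -[X in X < _]lnK ?posrE ?ltr0n // ltr_expR.
  have n0 : 0 <= n`!%:R * \prod_(j < n) (2 * radius r j (t - d_star r)).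
    by rewrite mulr_ge0 // prodr_ge0 // => j _; rewrite mulr_ge0 // ltW // radius_gt0.
  apply: (@le_lt_trans _ _ (\prod_i (q i)%:R * (n`!%:R * \prod_(j < n) (2 * radius r j (t - d_star r))))).
    by rewrite ler_wpM2l // prodr_ge0.
  have f0 : (0 : R) < n`!%:R by rewrite ltr0n fact_gt0.
  have p0 : 0 < n`!%:R * \prod_(j < n) (2 * radius r j (t - d_star r)).
    by rewrite mulr_gt0 // prodr_gt0 // => j _; rewrite mulr_gt0 // radius_gt0.
  apply: (@lt_le_trans _ _ (expR (n.+1%:R * (t - l_star r)) *
     (n`!%:R * \prod_(j < n) (2 * radius r j (t - d_star r))))).
    by rewrite ltr_pM2r.
  rewrite big_split /= prodr_const card_ord prod_radius //.
  rewrite -{1}(@lnK _ (n`!%:R)) ?posrE // -{1}(@lnK _ (2:R)) ?posrE // -expRM_natl.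
  rewrite -!expRD -[X in _ <= X]expR0 ler_expR /l_star /d_star.
  (* Equality holds: [l_star] solves [(n + 1) * (l_star - d_star) = ln n! + n * ln 2]. *)
  rewrite le_eqVlt; apply/orP; left; apply/eqP.
  by field; rewrite ?pnatr_eq0 ?gt_eqF // addr_gt0 // rmin_gt0.
have [u u0 Hu] : exists2 u : 'cV[R]_(1 + n), u != 0 & forall v, P v -> v *m u = 0.
  exact: (@hyperplane_of_dets R n P dets).
pose a : 'rV[R]_n := (dsubmx u)^T.
pose b : R := - u 0 0.
have uE (q : nat) p : P (row_mx 1%:M (ratpt q p)) ->
    \sum_(i < n) a 0 i * ratpt q p 0 i = b.
  move=> /Hu/matrixP/(_ 0 0); rewrite -[u]vsubmxK mul_row_col mul1mx !mxE.
  rewrite /b => /eqP; rewrite addrC addr_eq0 => /eqP.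
  rewrite (_ : lshift n 0 = 0); last exact: val_inj.
  move=> <-; apply: eq_bigr => i _; rewrite mulrC /a !mxE //.
exists [set x : 'rV[R]_n | \sum_(i < n) a 0 i * x 0 i = b]; last first.
  by move=> q p q0 lq bq; apply: uE; exists q, p.
(* If [a] vanished, the equation at one actual point of [P] would force [b = 0], hence [u = 0]. This
   is why the case without points was split off. *)
exists a, b; split => //; apply: contra_neq u0 => a0.
have [q [p HP]] := Pw.
have := uE q p; rewrite a0.
rewrite big1; last by move=> i _; rewrite mxE mul0r.
move=> b0; have {b0} : 0 = b by apply: b0; exists q, p; have [? ? ? _] := HP.
rewrite /b => /esym/eqP; rewrite oppr_eq0 => /eqP u00.
rewrite -[u]vsubmxK -[dsubmx _]trmxK -/a a0 trmx0.
rewrite (_ : usubmx u = 0) ?col_mx0 //.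
apply/matrixP => i j; rewrite !ord1 !mxE -[RHS]u00; congr (u _ _); exact: val_inj.
Qed.

(** Smaller denominators are inherited from the parent. A new obstacle close to a point of the child
    lies in the tripled parent box, hence on [S], and the child then lies in the tripled child-sized
    box around it. *)
Lemma away_child (c t : R) (x : 'rV[R]_n) : 0 <= c ->
  away r (ln 2 + 2 * c + l_star r) (t - l_star r - c) x t ->
  exists2 S, @affine_hyperplanes R n S &
    forall y, box r y (t + c) `<=` box r x t ->
      ~ (box r y (t + c) `<=` nbhd r S (t + c - d_star r)) ->
      away r (ln 2 + 2 * c + l_star r) (t - l_star r) y (t + c).
Proof.
move=> c0 aw; have [S HS HSx] := simplex_lemma x t; exists S => // y yx ny.
move=> z zy q p q0 lq; have [lq'|lq'] := ltP (ln q%:R) (t - l_star r - c).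
  by apply: aw => //; exact: yx.
apply/not_existsP => noi; apply: ny => w wy.
have close i : `|z 0 i - ratpt q p 0 i| <= 2^-1 * radius r i (t + c).
  have /negP := noi i; rewrite -ltNge mxE => /ltW/le_trans; apply.
  (* Here [ln q >= t - l_star - c] makes [ln q + (ln 2 + 2 * c + l_star)] at least [t + c + ln 2];
     the [ln 2] provides the factor 1/2. *)
  apply: (@le_trans _ _ (radius r i (t + c + ln 2))); first by apply: radius_le => //; lra.
  rewrite radiusD mulrC ler_wpM2r ?(ltW (radius_gt0 _ _ _)) //.
  exact/ltW/radius_ln2_lt.
exists (ratpt q p).
  apply: HSx => //; apply/boxP => i.
  have /boxP/(_ i) zx := yx _ zy.
  have rle : radius r i (t + c) <= radius r i t by apply: radius_le => //; lra.
  have := radius_subd_star r_gt0 i t; have := close i; have := radius_gt0 r i t.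
  by move: zx; rewrite !ler_norml => /andP[? ?] ? /andP[? ?] ?; apply/andP; split; lra.
apply/boxP => i; have := radius_subd_star r_gt0 i (t + c).
have := close i; have := radius_gt0 r i (t + c).
move/boxP/(_ i): wy; move/boxP/(_ i): zy.
by rewrite !ler_norml => /andP[? ?] /andP[? ?] ? /andP[? ?] ?; apply/andP; split; lra.
Qed.

End SimplexLemma.

(** * Measures with a power law *)

Section BorelSets.
Variables (R : realType) (n : nat).

Lemma continuous_sum (T : topologicalType) (I : Type) (s : seq I)
    (f : I -> T -> R) : (forall i, continuous (f i)) ->
  continuous (fun x => \sum_(i <- s) f i x).
Proof.
move=> cf; elim: s => [|i s IH].
  rewrite (_ : (fun x => _) = fun=> 0); first exact: cst_continuous.
  by apply/funext => x; rewrite big_nil.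
rewrite (_ : (fun x => _) = (fun x => f i x + \sum_(j <- s) f j x)).
  by move=> x; apply: continuousD; [exact: cf|exact: IH].
by apply/funext => x; rewrite big_cons.
Qed.

Lemma continuous_coord i : continuous (fun x : 'rV[R]_n => x 0 i).
Proof. exact: coord_continuous. Qed.

Lemma closed_sublevel (f : 'rV[R]_n -> R) (a : R) : continuous f ->
  closed [set x | f x <= a].
Proof.
move=> cf; rewrite (_ : [set x | _] = f @^-1` [set y | y <= a]) //.
by apply: (continuous_closedP f).1 => //; exact: closed_le.
Qed.

Lemma closed_measurable (A : set 'rV[R]_n) : closed A ->
  measurable (A : set (borelRn R n)).
Proof.
move=> cA; rewrite -[A]setCK; apply: measurableC; apply: sub_sigma_algebra.
exact: closed_openC.
Qed.

Lemma open_measurable_borelRn (A : set 'rV[R]_n) : open A ->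
  measurable (A : set (borelRn R n)).
Proof. by move=> oA; apply: sub_sigma_algebra. Qed.

Lemma closed_box (r : 'I_n -> R) x t : closed (box r x t).
Proof.
rewrite (_ : box r x t = \bigcap_(i in [set: 'I_n])
   ([set y : 'rV[R]_n | `|y 0 i - x 0 i| <= radius r i t])).
  apply: closed_bigI => i _; apply: closed_sublevel => y.
  apply: (@continuous_comp _ _ _ (fun y : 'rV[R]_n => y 0 i - x 0 i) Num.norm);
    last exact: norm_continuous.
  by apply: continuousB; [exact: continuous_coord|exact: cst_continuous].
apply/seteqP; split=> y.
  by move=> /boxP H i _; exact: H.
by move=> H; apply/boxP => i; exact: H.
Qed.

Lemma closed_euclid_ball (x : 'rV[R]_n) rho : closed (euclid_ball x rho).
Proof.
apply: closed_sublevel => y; apply: continuous_comp; last exact: sqrt_continuous.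
apply: continuous_sum => i z; rewrite /=.
apply: (@continuous_comp _ _ _ (fun z : 'rV[R]_n => x 0 i - z 0 i) (fun u => u ^+ 2)).
  by apply: continuousB; [exact: cst_continuous|exact: continuous_coord].
exact: exprn_continuous.
Qed.

(** The neighbourhood is the closed slab of points where the affine form is at most [w] in absolute
    value, [w] being its largest variation from the centre of a box. *)
Lemma closed_nbhd_hyperplane (r : 'I_n -> R) S t :
  @affine_hyperplanes R n S -> closed (nbhd r S t).
Proof.
move=> [a [b [a0 ->]]].
pose w := \sum_(i < n) `|a 0 i| * radius r i t.
have w0 : 0 < w.
  have [i ai] : exists i, a 0 i != 0.
    apply/not_existsP => H; case/negP: a0; apply/eqP/rowP => i; rewrite mxE.
    by apply/eqP; apply: contraT => ?; have := H i.
  rewrite /w (bigD1 i) //= ltr_pwDl //; first by rewrite mulr_gt0 ?normr_gt0 ?radius_gt0.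
  by apply: sumr_ge0 => j _; rewrite mulr_ge0 // ltW // radius_gt0.
rewrite (_ : nbhd _ _ _ = [set x : 'rV[R]_n | `|\sum_(i < n) a 0 i * x 0 i - b| <= w]).
  apply: closed_sublevel => y.
  apply: (@continuous_comp _ _ _ (fun y : 'rV[R]_n => \sum_(i < n) a 0 i * y 0 i - b) Num.norm);
    last exact: norm_continuous.
  apply: continuousB; last exact: cst_continuous.
  apply: continuous_sum => i z.
  by apply: continuousM; [exact: cst_continuous|exact: continuous_coord].
apply/seteqP; split => [x [y /= yb /boxP xy]|x /= xw].
  rewrite -yb -sumrB; apply: le_trans (ler_norm_sum _ _ _) _.
  by apply: ler_sum => i _; rewrite -mulrBr normrM ler_wpM2l // xy.
pose th := (\sum_(i < n) a 0 i * x 0 i - b) / w.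
(* Move towards the hyperplane by the fraction [th] of the corner displacement along which the
   linear form grows fastest. *)
exists (\row_i (x 0 i - th * (Num.sg (a 0 i) * radius r i t))) => /=.
  under eq_bigr => i _ do rewrite mxE mulrBr.
  rewrite sumrB [X in _ - X](eq_bigr (fun i => th * (`|a 0 i| * radius r i t))); last first.
    by move=> i _; rewrite normrEsg; ring.
  rewrite -mulr_sumr -/w /th divfK ?gt_eqF //; ring.
apply/boxP => i; rewrite mxE opprB addrC subrK normrM.
rewrite -[leRHS]mul1r ler_pM //.
  by rewrite /th normrM normfV (gtr0_norm w0) ler_pdivrMr // mul1r.
rewrite normrM (ger0_norm (ltW (radius_gt0 r i t))) ler_piMl ?(ltW (radius_gt0 r i t)) //.
by rewrite normr_sg; case: (_ != 0).
Qed.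

Lemma ball_rowP (x y : 'rV[R]_n) e : 0 < e ->
  (forall i, `|x 0 i - y 0 i| < e) -> ball x e y.
Proof. by move=> e0 H; split => // i j; rewrite !ord1; exact: H. Qed.

Lemma closed_measure_support (mu : set 'rV[R]_n -> \bar R) :
  closed (measure_support mu).
Proof.
rewrite -openC openE => x /existsNP[U /not_implyP[oU /not_implyP[Ux nU]]].
apply: (@filterS _ (nbhs x) _ U); last exact: open_nbhs_nbhs.
by move=> y Uy /(_ U oU Uy).
Qed.

(** Second countability: countably many null balls with rational centres and radii [1 / (k + 1)]
    cover the complement of the support. *)
Lemma measure_supportC (mu : {measure set (borelRn R n) -> \bar R}) :
  mu (~` measure_support mu) = 0%E.
Proof.
pose B (p : 'rV[rat]_n * nat) : set 'rV[R]_n :=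
  ball (map_mx ratr p.1 : 'rV[R]_n) (p.2.+1%:R^-1).
have e0 k : 0 < k.+1%:R^-1 :> R by rewrite invr_gt0.
have mB p : measurable (B p : set (borelRn R n)).
  by apply: open_measurable_borelRn; exact: ball_open.
pose F j : set (borelRn R n) := if unpickle j is Some p then
  if mu (B p) == 0%E then B p else set0 else set0.
have mF j : measurable (F j).
  by rewrite /F; case: unpickle => // p; case: ifP.
have muF j : mu (F j) = 0%E.
  by rewrite /F; case: unpickle => [p|]; rewrite ?measure0 //; case: ifP => [/eqP|].
apply/eqP; rewrite eq_le measure_ge0 andbT.
apply: (@le_trans _ _ (\sum_(j <oo) mu (F j))%E); last by rewrite eseries0.
apply: measure_sigma_subadditive => //.
  apply: open_measurable_borelRn; apply: closed_openC; exact: closed_measure_support.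
move=> x /existsNP[U /not_implyP[oU /not_implyP[Ux nU]]].
have [e /= e_gt0 eU] : exists2 e : R, 0 < e & ball x e `<=` U.
  have /nbhs_ballP[e /= ? ?] : nbhs (x : 'rV[R]_n) U by exact: open_nbhs_nbhs.
  by exists e.
(* A ball of radius [1 / (k + 1)] whose centre is that close to [x] stays within [e] of [x]. *)
pose k := Num.truncn (2 / e).
have ke : 2 * k.+1%:R^-1 < e.
  have := truncnS_gt (2 / e); rewrite -/k => ek.
  by rewrite ltr_pdivrMr // mulrC -ltr_pdivrMr.
have /choice[q Hq] i : exists q : rat, `|ratr q - x 0 i| < k.+1%:R^-1.
  have [q] := rat_in_itvoo (ltac:(by rewrite -subr_gt0 opprB addrC addrA subrK addr_gt0)
    : x 0 i - k.+1%:R^-1 < x 0 i + k.+1%:R^-1).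
  rewrite in_itv /= => /andP[? ?]; exists q.
  by rewrite ltr_distl; apply/andP.
pose p : 'rV[rat]_n * nat := (\row_i q i, k).
have Bx : B p x by apply: ball_rowP => // i; rewrite !mxE.
have BU : B p `<=` U.
  move=> y By; apply: eU; apply: ball_rowP => // i.
  have h1 : `|ratr (q i) - y 0 i| < k.+1%:R^-1 by have := By.2 0 i; rewrite /ball /= !mxE.
  rewrite -[x 0 i](subrK (ratr (q i))) -addrA; apply: le_lt_trans (ler_normD _ _) _.
  by apply: le_lt_trans ke; rewrite distrC mulr_natl mulr2n lerD // ltW // Hq.
have B0 : mu (B p) = 0%E.
  apply/eqP; rewrite eq_le measure_ge0 andbT leNgt; apply/negP => mB0.
  apply: nU; apply: lt_le_trans mB0 _; apply: le_measure; rewrite ?inE //.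
  exact: open_measurable_borelRn.
by exists (pickle p) => //; rewrite /F pickleK B0 eqxx.
Qed.

Lemma measure_disjoint_seq (mu : {measure set (borelRn R n) -> \bar R})
    (s : seq 'rV[R]_n) (F : 'rV[R]_n -> set 'rV[R]_n) (B : set 'rV[R]_n) :
  uniq s -> measurable (B : set (borelRn R n)) ->
  (forall y, y \in s -> measurable (F y : set (borelRn R n)) /\ F y `<=` B) ->
  (forall y z, y \in s -> z \in s -> y != z -> F y `&` F z = set0) ->
  (\sum_(y <- s) mu (F y) <= mu B)%E.
Proof.
elim: s B => [|y s IH] B; first by rewrite big_nil measure_ge0.
move=> /= /andP[ys us] mB HF dis; rewrite big_cons.
have [mFy FyB] := HF y (mem_head _ _).
rewrite (measureDI mu mB mFy) addeC; apply: leeD; last first.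
  apply: le_measure; rewrite ?inE //; first exact: measurableI.
  by move=> u Fu; split=> //; exact: FyB.
apply: IH => //; first exact: measurableD.
  move=> z zs; have zys : z \in y :: s by rewrite inE zs orbT.
  have [mFz FzB] := HF z zys; split=> // u Fzu.
  split; first exact: FzB.
  move=> Fyu; have yz : y != z by apply: contraNneq ys => ->.
  have := dis y z (mem_head _ _) zys yz.
  by move/seteqP => [+ _] => /(_ u (conj Fyu Fzu)).
by move=> u v us' vs; apply: dis; rewrite inE ?us' ?vs orbT.
Qed.

Lemma measure_seq_cover (mu : {measure set (borelRn R n) -> \bar R})
    (s : seq 'rV[R]_n) (F : 'rV[R]_n -> set 'rV[R]_n) (A B : set 'rV[R]_n) :
  measurable (A : set (borelRn R n)) -> measurable (B : set (borelRn R n)) ->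
  (forall y, measurable (F y : set (borelRn R n))) ->
  (forall u, B u -> A u \/ exists2 y, y \in s & F y u) ->
  (mu B <= mu A + \sum_(y <- s) mu (F y))%E.
Proof.
move=> mA; elim: s B => [|y s IH] B mB mF cov.
  rewrite big_nil adde0; apply: le_measure; rewrite ?inE //.
  by move=> u /cov[|[]].
rewrite big_cons addeCA (measureDI mu mB (mF y)) addeC; apply: leeD; last first.
  by apply: le_measure; rewrite ?inE //; exact: measurableI.
apply: IH => //; first exact: measurableD.
move=> u [/cov[|[z]]]; first by left.
by rewrite inE => /orP[/eqP ->|zs] // ? _; right; exists z.
Qed.

End BorelSets.

(** The bound [N] allows a family of largest size, to which nothing can be added. The alternative
    [y = z] covers members of [s] with empty [F y]. *)
Lemma max_packing (T : choiceType) (U : Type) (G : set T) (F : T -> set U) (N : nat) :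
  (forall s, uniq s -> (forall y, y \in s -> G y) ->
     (forall y z, y \in s -> z \in s -> y != z -> F y `&` F z = set0) ->
     (size s <= N)%N) ->
  exists s : seq T, [/\ uniq s, forall y, y \in s -> G y,
    forall y z, y \in s -> z \in s -> y != z -> F y `&` F z = set0 &
    forall y, G y -> exists2 z, z \in s & y = z \/ F y `&` F z !=set0].
Proof.
move=> bound.
pose P k := `[< exists s, [/\ uniq s, forall y, y \in s -> G y,
    forall y z, y \in s -> z \in s -> y != z -> F y `&` F z = set0 & size s = k] >].
have P0 : exists k, P k by exists 0%N; apply/asboolP; exists [::]; split.
have PN k : P k -> (k <= N)%N.
  by move=> /asboolP[s [us sG ds <-]]; exact: bound.
case: (ex_maxnP P0 PN) => k /asboolP[s [us sG ds sk]] kmax.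
exists s; split => // y Gy; apply: contrapT => H.
have Hd z : z \in s -> y != z /\ F y `&` F z = set0.
  move=> zs; split; first by apply/eqP => yz; apply: H; exists z => //; left.
  apply/eqP; apply: contrapT => ne; apply: H; exists z => //; right.
  exact/set0P/negP.
have : P k.+1.
  apply/asboolP; exists (y :: s); split.
  - by rewrite /= us andbT; apply/negP => /Hd[]; rewrite eqxx.
  - by move=> z; rewrite inE => /orP[/eqP ->|/sG].
  - move=> a b; rewrite !inE => /orP[/eqP->|as_] /orP[/eqP->|bs].
    + by rewrite eqxx.
    + by move=> _; exact: (Hd _ bs).2.
    + by move=> _; rewrite setIC; exact: (Hd _ as_).2.
    + exact: ds.
  - by rewrite /= sk.
by move/kmax; rewrite ltnn.
Qed.

(** The lower pointwise dimension is an extended real, possibly [+oo], so the estimate is made for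
    every real [d] below it. *)
Lemma le_of_lower_dims (R : realType) (D H : \bar R) (c : R) :
  (forall d : R, (d%:E < D)%E -> ((d - c)%:E <= H)%E) -> (D - c%:E <= H)%E.
Proof.
case: D => [x| |] HD; last by rewrite leNye.
- apply/lee_addgt0Pr => e e0; have : ((x - e)%:E < x%:E)%E by rewrite lte_fin; lra.
  move/HD => /(leeD2r e%:E); rewrite -!EFinD; apply: le_trans.
  by rewrite lee_fin; lra.
- suff -> : H = +oo%E by rewrite leey.
  apply/eqyP => A A0; have := HD (A + c) (ltry _).
  by rewrite addrK.
Qed.

Lemma measure_ball_le (R : realType) (n : nat) (mu : set 'rV[R]_n -> \bar R)
    (X : set 'rV[R]_n) (x : 'rV[R]_n) (d d' : R) :
  (forall A, 0 <= mu A)%E -> X x -> d' < d ->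
  (d%:E < lower_pointwise_dim mu X)%E ->
  exists rho0, 0 < rho0 /\ forall rho, 0 < rho -> rho < rho0 ->
    (mu (euclid_ball x rho) <= (rho `^ d')%:E)%E.
Proof.
move=> mu0 Xx dd' /lt_le_trans/(_ (ereal_inf_lbound _)).
move=> /(_ _ (ex_intro2 _ _ x Xx erefl)); rewrite limf_einfE.
move=> /ereal_sup_gt[_ [V V0 <-] dV].
have [e /= e0 eV] : exists2 e : R, 0 < e & forall rho, 0 < rho -> rho < e -> V rho.
  move: V0; rewrite /at_right /within /= => /nbhs_ballP[e /= e0 He]; exists e => // rho r0 re.
  by apply: He => //; rewrite /ball /= sub0r normrN gtr0_norm.
(* Below 1 the logarithm is negative: multiplying by it reverses the inequality, and an infinite
   mass would make the quotient [-oo]. *)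
exists (Num.min e 1); rewrite lt_min e0 ltr01; split => // rho r0.
rewrite lt_min => /andP[re r1].
have := lt_le_trans dV (ereal_inf_lbound (ex_intro2 _ _ rho (eV rho r0 re) erefl)).
have lnr : ln rho < 0 by rewrite ln_lt0 // r0.
case: (mu (euclid_ball x rho)) (mu0 (euclid_ball x rho)) => [v|_|//].
  rewrite lee_fin le_eqVlt => /orP[/eqP <- _|v0]; first by rewrite lee_fin powR_ge0.
  rewrite lne_EFin // -EFinM lte_fin ltr_ndivlMr // => H.
  rewrite lee_fin -[leLHS]lnK ?posrE // /powR gt_eqF // ler_expR.
  apply: le_trans (ltW H) _; rewrite ler_nM2r // ltW //.
by rewrite /= lt0_mulye // lte_fin invr_lt0.
Qed.

Section PowerLawChildren.
Variables (R : realType) (n : nat) (r : 'I_n -> R).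
Hypotheses (n_ge1 : (1 <= n)%N) (r_gt0 : forall i, 0 < r i)
  (r_sum1 : \sum_(i < n) r i = 1).
Variables (mu : {measure set (borelRn R n) -> \bar R}) (tau c1 c2 cd delta : R).
Let X := measure_support mu.
Hypotheses (X0 : X !=set0) (c1_gt0 : 0 < c1) (c12 : c1 <= c2)
  (mu_power : power_law r mu X tau c1 c2)
  (mu_decay : abs_decaying r mu X (@affine_hyperplanes R n) cd delta).

Lemma box_center x t : box r x t x.
Proof. by apply/boxP => i; rewrite subrr normr0 ltW // radius_gt0. Qed.

Lemma measurable_box x t : measurable (box r x t : set (borelRn R n)).
Proof. by apply: closed_measurable; exact: closed_box. Qed.

Lemma mu_box_real x t : X x -> exists2 m : R, mu (box r x t) = m%:E &
  c1 * expR (- (tau * t)) <= m <= c2 * expR (- (tau * t)).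
Proof.
move=> Xx; have [] := mu_power t Xx.
case: (mu (box r x t)) => // m; rewrite !lee_fin => lo hi.
by exists m => //; rewrite lo hi.
Qed.

(** For [s = 0] and a hyperplane through [x], the neighbourhood contains the whole box. *)
Lemma decay_ge1 : 1 <= cd.
Proof.
have [x Xx] := X0; have [m mE /andP[mlo _]] := mu_box_real 0 Xx.
have m0 : 0 < m by apply: lt_le_trans mlo; rewrite mulr_gt0 // expR_gt0.
have i0 : 'I_n := Ordinal n_ge1.
pose S := [set y : 'rV[R]_n | \sum_(i < n) (delta_mx 0 i0 : 'rV[R]_n) 0 i * y 0 i = x 0 i0].
have HS : @affine_hyperplanes R n S.
  exists (delta_mx 0 i0), (x 0 i0); split => //.
  apply/eqP => /matrixP/(_ 0 i0); rewrite !mxE !eqxx /=; exact/eqP/oner_neq0.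
have := mu_decay 0 Xx HS (lexx 0).
rewrite addr0 mulr0 oppr0 expR0 mulr1.
rewrite (_ : box r x 0 `&` nbhd r S 0 = box r x 0) ?mE; last first.
  apply/seteqP; split => [y []//|y xy]; split => //; exists x => //.
  rewrite /S /= (bigD1 i0) //= mxE !eqxx mul1r big1 ?addr0 // => i ii.
  by rewrite mxE (negPf ii) andbF mul0r.
by rewrite -EFinM lee_fin -[X in X <= _]mul1r ler_pM2r.
Qed.

(* The children are a maximal family of disjoint boxes centred in the support,
   off the neighbourhood of [S]; by maximality the boxes enlarged by [d_star]
   cover what remains of the support. *)
Lemma packing_children (c : R) (x : 'rV[R]_n) (t : R) (S : set 'rV[R]_n) :
  2 * d_star r < c -> X x -> @affine_hyperplanes R n S ->
  let q := cd * expR (- (delta * (c - 2 * d_star r))) in q < 1 ->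
  exists s : seq 'rV[R]_n, [/\ uniq s,
    forall y, y \in s -> [/\ X y, box r y (t + c) `<=` box r x t &
                            ~ nbhd r S (t + c - d_star r) y],
    forall y z, y \in s -> z \in s -> y != z ->
      box r y (t + c) `&` box r z (t + c) = set0 &
    (((c1 / c2) ^+ 2 * expR (- (2 * tau * d_star r)) * (1 - q))%:E * mu (box r x t)
       <= \sum_(y <- s) mu (box r y (t + c)))%E].
Proof.
move=> cd2 Xx HS q q1; have ds0 := d_star_gt0 r_gt0.
have c0 : 0 < c by lra.
pose d := d_star r.
(* Centres are kept in the box of scale [t + d], so that boxes of scale [t + c] around them stay
   inside the parent. *)
pose G := X `&` (box r x (t + d) `&` ~` nbhd r S (t + c - d)).
have Gx y : G y -> box r y (t + c) `<=` box r x t.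
  move=> [_ [/boxP xy _]] z /boxP yz; apply/boxP => i.
  have h1 : 3 * radius r i (t + d) <= radius r i t.
    by have := radius_subd_star r_gt0 i (t + d); rewrite addrK.
  have h2 : 3 * radius r i (t + c) <= radius r i t.
    apply: le_trans (radius_subd_star r_gt0 i _) _.
    by apply: radius_le => //; lra.
  have := radius_gt0 r i t; move: (xy i) (yz i); rewrite !ler_norml.
  by move=> /andP[? ?] /andP[? ?] ?; apply/andP; split; lra.
pose a := expR (- (tau * t)); pose e := expR (- (tau * d)); pose k := expR (- (tau * c)).
have a0 : 0 < a by exact: expR_gt0.
have e0 : 0 < e by exact: expR_gt0.
have k0 : 0 < k by exact: expR_gt0.
have c20 : 0 < c2 by exact: lt_le_trans c12.
have atd : expR (- (tau * (t + d))) = a * e by rewrite -expRD; congr expR; ring.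
have atc : expR (- (tau * (t + c))) = a * k by rewrite -expRD; congr expR; ring.
have atcd : expR (- (tau * (t + c - d))) = a * k / e.
  by rewrite -expRN -!expRD; congr expR; ring.
have lower (s : seq 'rV[R]_n) : (forall y, y \in s -> G y) ->
    (((size s)%:R * (c1 * (a * k)))%:E <= \sum_(y <- s) mu (box r y (t + c)))%E.
  move=> sG; apply: (@le_trans _ _ (\sum_(y <- s) (c1 * (a * k))%:E)%E).
    by rewrite sumEFin big_const_seq count_predT iter_addr_0 mulr_natl.
  rewrite big_seq [leRHS]big_seq; apply: lee_sum => y /sG[Xy _].
  by have [m -> /andP[+ _]] := mu_box_real (t + c) Xy; rewrite lee_fin atc.
have [mx mxE /andP[mxlo mxhi]] := mu_box_real t Xx.
have sumle (s : seq 'rV[R]_n) : uniq s -> (forall y, y \in s -> G y) ->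
    (forall y z, y \in s -> z \in s -> y != z ->
      box r y (t + c) `&` box r z (t + c) = set0) ->
    (\sum_(y <- s) mu (box r y (t + c)) <= mu (box r x t))%E.
  move=> us sG ds; apply: measure_disjoint_seq => //; first exact: measurable_box.
  by move=> y ys; split; [exact: measurable_box|exact: Gx (sG _ ys)].
(* Disjoint children of mass at least [c1 * (a * k)] inside a parent of mass at most [c2 * a] are
   bounded in number. *)
have [s [us sG ds cov]] := @max_packing _ _ G (fun y => box r y (t + c))
    (Num.truncn (c2 * a / (c1 * (a * k)))) (fun s us sG ds => ltac:(
      rewrite truncn_ge_nat ?divr_ge0 ?mulr_ge0 ?(ltW a0) ?(ltW k0) ?(ltW c1_gt0) ?(ltW c20) //;
      rewrite ler_pdivlMr ?mulr_gt0 //;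
      rewrite -lee_fin; apply: (le_trans (lower s sG)); apply: (le_trans (sumle s us sG ds));
      rewrite mxE lee_fin; exact: mxhi)).
exists s; split => //.
  move=> y ys; have [Xy [_ ny]] := sG _ ys; split => //.
  exact: Gx (sG _ ys).
have [m mE /andP[mlo mhi]] := mu_box_real (t + d) Xx.
have mNb : measurable (nbhd r S (t + c - d) : set (borelRn R n)).
  by apply: closed_measurable; exact: closed_nbhd_hyperplane.
have mXc : measurable (~` X : set (borelRn R n)).
  by apply: open_measurable_borelRn; apply: closed_openC; exact: closed_measure_support.
have covm : (mu (box r x (t + d)) <= mu ((box r x (t + d) `&` nbhd r S (t + c - d)) `|` ~` X) +
    \sum_(y <- s) mu (box r y (t + c - d)))%E.
  apply: measure_seq_cover => //; [|exact: measurable_box|by move=> y; exact: measurable_box|].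
    by apply: measurableU => //; apply: measurableI => //; exact: measurable_box.
  move=> u xu; have [Xu|nXu] := pselect (X u); last by left; right.
  have [Nu|nNu] := pselect (nbhd r S (t + c - d) u); first by left; left.
  right; have [z zs Hz] := cov u (conj Xu (conj xu nNu)); exists z => //.
  case: Hz => [->|[v [/boxP uv /boxP zv]]]; first exact: box_center.
  apply/boxP => i; have := radius_subd_star r_gt0 i (t + c).
  have := radius_gt0 r i (t + c); move: (uv i) (zv i); rewrite !ler_norml.
  by move=> /andP[? ?] /andP[? ?] ? ?; apply/andP; split; lra.
have decm : (mu ((box r x (t + d) `&` nbhd r S (t + c - d)) `|` ~` X) <= (q * m)%:E)%E.
  apply: (@le_trans _ _ (mu (box r x (t + d) `&` nbhd r S (t + c - d)) + mu (~` X))%E).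
    by apply: measureU2 => //; apply: measurableI => //; exact: measurable_box.
  rewrite measure_supportC adde0.
  (* Decay is applied at scale [t + d] with [s = c - 2 * d], which lands on the scale [t + c - d] of
     the neighbourhood. *)
  have s0 : 0 <= c - 2 * d by rewrite /d; lra.
  have := mu_decay (t + d) Xx HS s0.
  by rewrite (_ : t + d + (c - 2 * d) = t + c - d) ?mE //; ring.
have upper : (\sum_(y <- s) mu (box r y (t + c - d)) <= ((size s)%:R * (c2 * (a * k / e)))%:E)%E.
  apply: (@le_trans _ _ (\sum_(y <- s) (c2 * (a * k / e))%:E)%E); last first.
    by rewrite sumEFin big_const_seq count_predT iter_addr_0 mulr_natl.
  rewrite big_seq [leRHS]big_seq; apply: lee_sum => y /sG[Xy _].
  by have [m' -> /andP[_ +]] := mu_box_real (t + c - d) Xy; rewrite lee_fin atcd.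
(* The power law turns mass into a count of children at the cost of one factor [c1 / c2]; going back
   to mass costs the second. The two shifts by [d] give [e * e]. *)
have main : (1 - q) * (c1 * (a * e)) <= (size s)%:R * (c2 * (a * k / e)).
  have : m <= q * m + (size s)%:R * (c2 * (a * k / e)).
    by rewrite -lee_fin -mE; apply: (le_trans covm); rewrite EFinD leeD.
  rewrite -atd; move: mlo; nra.
apply: le_trans (lower s sG); rewrite mxE -EFinM lee_fin.
have e2 : expR (- (2 * tau * d_star r)) = e * e by rewrite -expRD -/d; congr expR; ring.
rewrite e2; apply: (@le_trans _ _ ((c1 / c2) ^+ 2 * (e * e) * (1 - q) * (c2 * a))).
  apply: ler_wpM2l mxhi; rewrite mulr_ge0 ?subr_ge0 ?(ltW q1) //.
  by rewrite mulr_ge0 ?sqr_ge0 // mulr_ge0 // ltW.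
have f0 : 0 < c1 * e / c2 by rewrite divr_gt0 // mulr_gt0.
have := ler_wpM2l (ltW f0) main.
rewrite (_ : c1 * e / c2 * ((1 - q) * (c1 * (a * e))) =
  (c1 / c2) ^+ 2 * (e * e) * (1 - q) * (c2 * a)); last by field; rewrite gt_eqF.
rewrite (_ : c1 * e / c2 * ((size s)%:R * (c2 * (a * k / e))) =
  (size s)%:R * (c1 * (a * k))) //.
by field; rewrite !gt_eqF.
Qed.

End PowerLawChildren.

Section PowerLawDimension.
Variables (R : realType) (n : nat) (r : 'I_n -> R).
Hypotheses (n_ge1 : (1 <= n)%N) (r_gt0 : forall i, 0 < r i)
  (r_sum1 : \sum_(i < n) r i = 1).

Lemma l_star_gt0 : 0 < l_star r.
Proof.
have : 0 < d_star r by exact: d_star_gt0.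
rewrite /l_star /d_star => h; rewrite ltr_wpDl // addr_ge0 //.
  by rewrite divr_ge0 // ln_ge0 // ler1n fact_gt0.
by rewrite mulr_ge0 ?divr_ge0 // ln_ge0 // ler1n.
Qed.

Lemma box_diam x t y z : 0 <= t -> box r x t y -> box r x t z ->
  euclid_dist y z <= n%:R * (2 * expR (- ((1 + rmin r) * t))).
Proof.
move=> t0 /boxP xy /boxP xz; apply: euclid_dist_le.
  by rewrite mulr_ge0 // expR_ge0.
move=> i; have : radius r i t <= expR (- ((1 + rmin r) * t)).
  by rewrite ler_expR lerN2 ler_wpM2r // lerD2l rmin_le.
move: (xy i) (xz i); rewrite !ler_norml => /andP[? ?] /andP[? ?] ?.
by apply/andP; split; lra.
Qed.

Lemma measure_support_limit (mu : set 'rV[R]_n -> \bar R) (z : 'rV[R]_n)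
    (u : nat -> 'rV[R]_n) (c t0 : R) : 0 < c -> 0 <= t0 ->
  (forall k, measure_support mu (u k)) -> (forall k, box r (u k) (t0 + k%:R * c) z) ->
  measure_support mu z.
Proof.
move=> c0 t00 Xu uz U oU Uz.
have /nbhs_ballP[e /= e0 eU] : nbhs z U by exact: open_nbhs_nbhs.
pose k := (Num.truncn (- ln e / c)).+1.
have kc : - ln e < k%:R * c by rewrite -ltr_pdivrMr //; exact: truncnS_gt.
have kc0 : 0 <= k%:R * c by rewrite mulr_ge0 // ltW.
apply: (Xu k U oU); apply: eU; apply: ball_rowP => // i; rewrite distrC distrC.
have /boxP/(_ i)/le_lt_trans := uz k; apply.
rewrite -[ltRHS]lnK ?posrE // ltr_expR ltrNl.
apply: (lt_le_trans kc); have := r_gt0 i; nra.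
Qed.

(** The children retain at least the fraction [Dl] of the mass, so [Dl ^ (- k) * mu] does not
    decrease in total. Each step divides the diameter bound by [expR ((1 + rmin) * c)], whence the
    loss [- ln Dl / ((1 + rmin) * c)]. *)
Lemma power_law_dim_ge (mu : {measure set (borelRn R n) -> \bar R})
    (tau c1 c2 cd delta c : R) :
  let X := measure_support mu in
  X !=set0 -> 0 < tau -> 0 < c1 -> c1 <= c2 -> power_law r mu X tau c1 c2 ->
  0 < cd -> 0 < delta -> abs_decaying r mu X (@affine_hyperplanes R n) cd delta ->
  ln cd / delta + 2 * d_star r < c ->
  (lower_pointwise_dim mu X -
     ((2 * ln (c2 / c1) + 2 * tau * d_star r +
       `|ln (1 - cd * expR (2 * delta * d_star r) * expR (- (delta * c)))|) /
      ((1 + rmin r) * c))%:E <=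
   hausdorff_dim (Bad r (2^-1 * expR (- (2 * c + l_star r))) `&` X))%E.
Proof.
move=> X X0 tau0 c10 c12 pl cd0 de0 dec cgt.
have cd1 : 1 <= cd by exact: (decay_ge1 n_ge1 X0 c10 pl dec).
have ds0 : 0 < d_star r by exact: d_star_gt0.
have lncd : 0 <= ln cd / delta by rewrite divr_ge0 ?ln_ge0 // ltW.
have c2d : 2 * d_star r < c by lra.
have c0 : 0 < c by lra.
pose q := cd * expR (- (delta * (c - 2 * d_star r))).
have qE : cd * expR (2 * delta * d_star r) * expR (- (delta * c)) = q.
  by rewrite /q -mulrA -expRD; congr (_ * expR _); ring.
have q0 : 0 < q by rewrite mulr_gt0 // expR_gt0.
have q1 : q < 1.
  rewrite /q -[X in X * _]lnK ?posrE // -expRD -[ltRHS]expR0 ltr_expR.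
  have : ln cd < (c - 2 * d_star r) * delta by rewrite -ltr_pdivrMr //; lra.
  by rewrite [delta * _]mulrC; lra.
have c20 : 0 < c2 by exact: lt_le_trans c12.
pose Dl := (c1 / c2) ^+ 2 * expR (- (2 * tau * d_star r)) * (1 - q).
have Dl0 : 0 < Dl by rewrite !mulr_gt0 ?expR_gt0 ?invr_gt0 ?subr_gt0.
have lnDl : 2 * ln (c2 / c1) + 2 * tau * d_star r + `|ln (1 - q)| = - ln Dl.
  have -> : `|ln (1 - q)| = - ln (1 - q).
    by rewrite ler0_norm // ln_le0 // gerBl ltW.
  have lnM3 (x y z : R) : 0 < x -> 0 < y -> 0 < z -> ln (x * y * z) = ln x + ln y + ln z.
    by move=> x0 y0 z0; rewrite !lnM ?posrE // mulr_gt0.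
  rewrite /Dl lnM3 ?exprn_gt0 ?divr_gt0 ?expR_gt0 ?subr_gt0 // expRK.
  rewrite lnXn ?divr_gt0 // !lnM ?posrE ?invr_gt0 // !lnV ?posrE //.
  by rewrite mulr2n; ring.
rewrite qE lnDl.
have lnc : 0 <= ln (c2 / c1) by rewrite ln_ge0 // ler_pdivlMr // mul1r.
have L0 : 0 <= - ln Dl.
  have td := mulr_gt0 tau0 ds0.
  by rewrite -lnDl; have := normr_ge0 (ln (1 - q)); nra.
apply: le_of_lower_dims => d dlt.
pose b := ln 2 + 2 * c + l_star r.
(* Starting at [l_star] makes [away] vacuous at the root, where it concerns only [ln q < - c]. *)
pose t k : R := l_star r + k%:R * c.
have ls0 := l_star_gt0.
have t0 k : 0 <= t k by rewrite addr_ge0 ?mulr_ge0 // ltW.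
have tS k : t k.+1 = t k + c by rewrite /t -natr1; ring.
have [x0 Xx0] := X0.
pose L := - ln Dl.
have expL : expR (- L) = Dl by rewrite opprK lnK ?posrE.
pose W (k : nat) x := ((expR (L * k%:R))%:E * mu (box r x (t k)))%E.
pose M y rho k x := mu (euclid_ball y rho `&` box r x (t k)).
pose good (k : nat) x := X x /\ away r b (t k - l_star r - c) x (t k).
have mb x s : measurable (box r x s : set (borelRn R n)) by exact: measurable_box.
have mM y rho k x : measurable (euclid_ball y rho `&` box r x (t k) : set (borelRn R n)).
  apply: measurableI; last exact: mb.
  by apply: closed_measurable; exact: closed_euclid_ball.
have kap0 : 0 < (1 + rmin r) * c by rewrite mulr_gt0 // addr_gt0 // rmin_gt0.
have [m0 m0E /andP[m0lo _]] := mu_box_real pl (t 0%N) Xx0.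
have m00 : 0 < m0 by apply: lt_le_trans m0lo; rewrite mulr_gt0 // expR_gt0.
apply: (@hausdorff_dim_ge _ _ _ good (fun k x => box r x (t k)) W M x0
  (n%:R * (2 * expR (- ((1 + rmin r) * l_star r)))) L ((1 + rmin r) * c) d m0) => //.
- by rewrite mulr_gt0 ?ltr0n // mulr_gt0 // expR_gt0.
- move=> k x y z xy xz; apply: le_trans (box_diam (t0 k) xy xz) _.
  rewrite -!mulrA -expRD le_eqVlt; apply/orP; left; apply/eqP.
  by congr (_ * (_ * expR _)); rewrite /t; ring.
- split => //; rewrite /t mul0r addr0 subrr sub0r => y _ q' p q'0 lq.
  exfalso; have : 0 <= ln q'%:R :> R by rewrite ln_ge0 // ler1n.
  lra.
- by rewrite /W mulr0 expR0 mul1e m0E.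
- move=> k x [Xx aw].
  have [S HS Sch] := away_child n_ge1 r_gt0 r_sum1 (ltW c0) aw.
  have [s [us sP ds sW]] := packing_children r_gt0 c10 c12 pl dec
     (t k) c2d Xx HS q1.
  exists s; split.
  + move=> y /sP[Xy yx nS]; rewrite /good tS; split => //; split => //.
    rewrite (_ : t k + c - l_star r - c = t k - l_star r); last ring.
    apply: Sch => // H; apply: nS; apply: H; exact: box_center.
  + rewrite /W -ge0_sume_distrr; last by move=> *; exact: measure_ge0.
    rewrite tS -natr1 mulrDr mulr1 expRD EFinM -muleA.
    apply: lee_wpmul2l; first by rewrite lee_fin expR_ge0.
    apply: (@le_trans _ _ ((expR L)%:E * (Dl%:E * mu (box r x (t k))))%E).
      by rewrite muleA -EFinM -expL -expRD subrr expR0 mul1e.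
    by apply: lee_wpmul2l; rewrite ?lee_fin ?expR_ge0.
  + move=> y rho; rewrite /M; apply: measure_disjoint_seq => //.
      move=> z zs; split => //; have [_ zx _] := sP _ zs.
      by rewrite -tS in zx; exact: setIS.
    move=> z z' zs z's zz'; have := ds z z' zs z's zz'; rewrite -tS.
    by rewrite setIACA => ->; rewrite setI0.
- move=> k x y rho _ sub; rewrite /W /M; apply: lee_wpmul2l.
    by rewrite lee_fin expR_ge0.
  apply: le_measure; rewrite ?inE //.
  by move=> z xz; split => //; exact: sub.
- move=> y [_ Xy] d' d'd.
  have [rho0 [rho00 H]] := measure_ball_le (fun A => measure_ge0 mu A) Xy d'd dlt.
  exists rho0; split => // rho r0 rr; apply: le_trans (H rho r0 rr).
  apply: le_measure; rewrite ?inE //.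
  by apply: closed_measurable; exact: closed_euclid_ball.
- move=> u gu nest; have [z Hz] := nested_boxes (t := t) nest.
  exists z; split => //; split; last first.
    by apply: (measure_support_limit c0 (ltW ls0)) => k; [exact: (gu k).1|exact: Hz].
  have e0 : 0 < 2^-1 * expR (- (2 * c + l_star r)) by rewrite mulr_gt0 // expR_gt0.
  apply: (Bad_of_away r_gt0 e0 (b := b)).
    by rewrite lnM ?posrE ?expR_gt0 // lnV ?posrE // expRK /b; lra.
  (* [away] lags one step behind: its threshold at level [K] is [(K - 1) * c], which must reach
     [k]. *)
  move=> k; pose K := (Num.truncn (k%:R / c)).+2.
  exists (t K - l_star r - c), (u K), (t K); split => //; last exact: (gu K).2.
  have : k%:R / c <= (Num.truncn (k%:R / c)).+1%:R by rewrite ltW // truncnS_gt.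
  rewrite ler_pdivrMr // /K /t -[in X in _ -> X]natr1; lra.
Qed.

End PowerLawDimension.

(** * Lebesgue measure and exact tilings *)

Section Lebesgue.
Variable R : realType.

(** Read off from the supremum over simple functions below the integrand, so that it applies to
    sections of arbitrary sets. *)
Lemma le_integral_nonneg (f g : R -> \bar R) : (forall x, 0 <= f x)%E ->
  (forall x, f x <= g x)%E ->
  (\int[lebesgue_measure]_(x in [set: R]) f x <=
   \int[lebesgue_measure]_(x in [set: R]) g x)%E.
Proof.
move=> f0 fg; have g0 x : (0 <= g x)%E by exact: le_trans (fg x).
rewrite !ge0_integralTE //; apply: le_ereal_sup.
by move=> _ [h hf <-]; exists h => // x; exact: le_trans (fg x).
Qed.

Lemma integral_step (k : R) (A : set R) : 0 <= k -> measurable A ->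
  (\int[lebesgue_measure]_(x in [set: R]) (k%:E * (\1_A x)%:E) =
   k%:E * lebesgue_measure A)%E.
Proof.
move=> k0 mA; rewrite ge0_integralZl_EFin //.
  by rewrite integral_indic ?setIT.
by apply/measurable_EFinP; exact: measurable_indic.
Qed.

Lemma lebesgueRn_ge0 n (A : set 'rV[R]_n) : (0 <= lebesgueRn A)%E.
Proof.
by elim: n A => [|n IH] A /=; [rewrite lee_fin|apply: integral_ge0 => x _; exact: IH].
Qed.

Lemma lebesgueRn_le n (A B : set 'rV[R]_n) : A `<=` B ->
  (lebesgueRn A <= lebesgueRn B)%E.
Proof.
elim: n A B => [|n IH] A B AB /=.
  rewrite lee_fin !indicE; have [A0|A0] := pselect (A 0); last by rewrite memNset.
  by rewrite (mem_set A0) (mem_set (AB _ A0)).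
apply: le_integral_nonneg => x; first exact: lebesgueRn_ge0.
by apply: IH => v; exact: AB.
Qed.

Definition hbox n (lo hi : 'I_n -> R) : set 'rV[R]_n :=
  [set v | forall k, lo k <= v 0 k < hi k].

Lemma row_mx_cons0 n (x : R) (v : 'rV[R]_n) :
  row_mx (x%:M : 'rV[R]_1) v 0 (0 : 'I_n.+1) = x.
Proof.
rewrite (_ : (0 : 'I_n.+1) = lshift n (0 : 'I_1)); last exact: val_inj.
by rewrite row_mxEl mxE eqxx.
Qed.

Lemma row_mx_consS n (x : R) (v : 'rV[R]_n) (k : 'I_n) :
  row_mx (x%:M : 'rV[R]_1) v 0 (lift (0 : 'I_n.+1) k) = v 0 k.
Proof.
rewrite (_ : lift (0 : 'I_n.+1) k = rshift 1 k); last exact: val_inj.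
by rewrite row_mxEr.
Qed.

(** Induction by slicing: the boxes whose first side contains [x] have disjoint sections, and [A] is
    compared by inclusion only. Half-open sides keep adjacent tiles disjoint. *)
Lemma lebesgueRn_ge n (I : finType) (T : {set I}) (lo hi : I -> 'I_n -> R)
    (A : set 'rV[R]_n) :
  (forall i k, i \in T -> lo i k <= hi i k) ->
  (forall i, i \in T -> hbox (lo i) (hi i) `<=` A) ->
  (forall i j v, i \in T -> j \in T -> hbox (lo i) (hi i) v ->
     hbox (lo j) (hi j) v -> i = j) ->
  ((\sum_(i in T) \prod_k (hi i k - lo i k))%:E <= lebesgueRn A)%E.
Proof.
elim: n T lo hi A => [|n IH] T lo hi A lohi sub dis /=.
  have all0 i : hbox (lo i) (hi i) (0 : 'rV[R]_0) by case.
  have [->|[i iT]] := set_0Vmem T; first by rewrite big_set0 lee_fin.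
  have -> : T = [set i]%SET.
    apply/setP => j; rewrite inE; apply/idP/eqP => [jT|-> //].
    exact: (dis _ _ 0 jT iT).
  rewrite big_set1 big_ord0 lee_fin indicE mem_set //.
  exact: (sub i iT).
pose vt i := \prod_(k < n) (hi i (lift ord0 k) - lo i (lift ord0 k)).
have vt0 i : i \in T -> 0 <= vt i.
  by move=> iT; apply: prodr_ge0 => k _; rewrite subr_ge0 lohi.
pose J i : set R := `[lo i ord0, hi i ord0[%classic.
pose g x : \bar R := (\sum_(i in T) (vt i)%:E * (\1_(J i) x)%:E)%E.
have -> : (\sum_(i in T) \prod_k (hi i k - lo i k))%:E =
    (\int[lebesgue_measure]_(x in [set: R]) g x)%E.
  (* The maximum with 0 keeps the summand nonnegative also for indices outside [T]. *)
  pose g' i x : \bar R := ((Num.max 0 (vt i))%:E * (\1_(J i) x)%:E)%E.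
  have -> : (\int[lebesgue_measure]_(x in [set: R]) g x =
      \int[lebesgue_measure]_(x in [set: R]) \sum_(i <- enum T) g' i x)%E.
    apply: eq_integral => x _; rewrite big_enum; apply: eq_bigr => i iT.
    by rewrite /g' max_r // vt0.
  rewrite ge0_integral_sum //; last 2 first.
    - move=> i; apply: emeasurable_funM; first exact: measurable_cst.
      by apply/measurable_EFinP; apply: measurable_indic; exact: measurable_itv.
    - by move=> i x _; rewrite mule_ge0 // lee_fin // le_max lexx.
  rewrite big_enum -sumEFin; apply: eq_bigr => i iT.
  rewrite /g' integral_step ?le_max ?lexx //; last exact: measurable_itv.
  rewrite max_r ?vt0 // /J lebesgue_measure_itv /= lte_fin big_ord_recl.
  have := lohi i ord0 iT; rewrite le_eqVlt => /orP[/eqP <-|->].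
    by rewrite ltxx subrr mul0r mule0.
  by rewrite -EFinB -EFinM mulrC.
apply: le_integral_nonneg => x.
  by apply: sume_ge0 => i iT; rewrite mule_ge0 // lee_fin ?vt0.
pose Tx := [set i in T | lo i ord0 <= x < hi i ord0]%SET.
have -> : g x = (\sum_(i in Tx) \prod_(k < n) (hi i (lift ord0 k) - lo i (lift ord0 k)))%:E.
  rewrite -sumEFin /g big_mkcond [RHS]big_mkcond; apply: eq_bigr => i _.
  rewrite inE; case: (i \in T) => //=; rewrite indicE.
  case: ifPn => Hx; first by rewrite mem_set ?mule1 //= in_itv.
  by rewrite memNset ?mule0 // /J /= in_itv /=; exact/negP.
apply: IH => [i k|i|i j v].
- by rewrite inE => /andP[iT _]; exact: lohi.
- rewrite inE => /andP[iT Hx] v Hv; apply: (sub i iT) => k.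
  by case: (unliftP ord0 k) => [k'|] ->; rewrite ?row_mx_consS ?row_mx_cons0.
- rewrite !inE => /andP[iT Hi] /andP[jT Hj] vi vj.
  apply: (dis i j (row_mx (x%:M : 'rV_1) v)) => // k;
  by case: (unliftP ord0 k) => [k'|] ->; rewrite ?row_mx_consS ?row_mx_cons0.
Qed.

Lemma lebesgueRn_rect_le n (x e : 'I_n -> R) : (forall i, 0 <= e i) ->
  (lebesgueRn [set y : 'rV[R]_n | forall i, (`|y 0 i - x i| <= e i)%R] <=
   (\prod_i (2 * e i)%R)%:E)%E.
Proof.
elim: n x e => [|n IH] x e e0 /=.
  by rewrite big_ord0 lee_fin indicE; case: (_ \in _).
pose vt := \prod_(k < n) (2 * e (lift ord0 k)).
have vt0 : 0 <= vt by apply: prodr_ge0 => k _; rewrite mulr_ge0.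
pose J : set R := `[x ord0 - e ord0, x ord0 + e ord0]%classic.
apply: (@le_trans _ _ (\int[lebesgue_measure]_(z in [set: R]) (vt%:E * (\1_J z)%:E))%E).
  apply: le_integral_nonneg => z; first exact: lebesgueRn_ge0.
  have [Jz|nJz] := pselect (J z).
    rewrite indicE mem_set // mule1; apply: le_trans (IH (x \o lift ord0) (e \o lift ord0) _);
      last by move=> i; exact: e0.
    apply: lebesgueRn_le => v Hv i; have := Hv (lift ord0 i).
    by rewrite row_mx_consS.
  rewrite indicE memNset // mule0.
  rewrite (_ : [set v | _] = set0); last first.
    apply/seteqP; split => // v /(_ ord0); rewrite row_mx_cons0 ler_distl => H.
    by apply: nJz; rewrite /J /= in_itv.
  elim: (n) => [|k IHk] /=; first by rewrite lee_fin indicE memNset.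
  rewrite integral0_eq // => _ _; apply/eqP; rewrite eq_le lebesgueRn_ge0 andbT.
  exact: IHk.
rewrite integral_step //; last exact: measurable_itv.
rewrite /J lebesgue_measure_itv /= lte_fin big_ord_recl.
case: ifPn => _.
  rewrite -EFinB -EFinM lee_fin mulrC ler_wpM2r //; lra.
by rewrite mule0 lee_fin mulr_ge0 // mulr_ge0.
Qed.

End Lebesgue.

Lemma unit_slot (R : realType) (u : R) (L : nat) : (0 < L)%N -> 0 <= u -> u <= L%:R ->
  exists2 j : nat, (j < L)%N & j%:R <= u <= j%:R + 1.
Proof.
case: L => // L _ u0 uL; have [uL'|uL'] := ltP u L%:R.
  have /andP[t1 t2] := truncn_itv u0.
  exists (Num.truncn u).
    by rewrite ltnS ltnW // -(ltr_nat R); exact: le_lt_trans uL'.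
  by rewrite t1 natr1 ltW.
by exists L => //; rewrite uL' /= natr1.
Qed.

Section Tiling.
Variables (R : realType) (n : nat).

Definition rect (x : 'rV[R]_n) (e : 'I_n -> R) : set 'rV[R]_n :=
  [set y | forall i, `|y 0 i - x 0 i| <= e i].

Lemma box_rect (r : 'I_n -> R) x t : box r x t = rect x (radius r ^~ t).
Proof. by apply/seteqP; split => y /boxP. Qed.

Definition clamp (a b u : R) : R := Num.max a (Num.min b u).

Lemma clamp_le a b u v : u <= v -> clamp a b u <= clamp a b v.
Proof. by move=> uv; rewrite /clamp le_max2 // le_min2. Qed.

Lemma clamp_id a b u : a <= u <= b -> clamp a b u = u.
Proof. by move=> /andP[au ub]; rewrite /clamp min_r // max_r. Qed.

Lemma clampB_le a b u v : a <= b -> clamp a b v - clamp a b u <= b - a.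
Proof.
move=> ab; apply: lerB; first by rewrite /clamp ge_max ab ge_min lexx.
by rewrite /clamp le_max lexx.
Qed.

(* The volume of the intersection of [rect x e] with the cube of centre [y]
   and half-side [rho]. *)
Definition cubevol (y : 'rV[R]_n) (rho : R) (x : 'rV[R]_n) (e : 'I_n -> R) : R :=
  \prod_i (clamp (y 0 i - rho) (y 0 i + rho) (x 0 i + e i) -
           clamp (y 0 i - rho) (y 0 i + rho) (x 0 i - e i)).

Lemma cubevol_ge0 y rho x e : (forall i, 0 <= e i) -> 0 <= cubevol y rho x e.
Proof.
move=> e0; apply: prodr_ge0 => i _; rewrite subr_ge0 clamp_le //.
by have := e0 i; lra.
Qed.

Lemma cubevol_le y rho x e : 0 <= rho -> (forall i, 0 <= e i) ->
  cubevol y rho x e <= (2 * rho) ^+ n.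
Proof.
move=> rho0 e0; rewrite -[X in _ ^+ X]card_ord -prodr_const.
apply: ler_prod => i _; rewrite subr_ge0 clamp_le /=; last by have := e0 i; lra.
by apply: le_trans (clampB_le _ _ _) _; lra.
Qed.

(** The ball lies in the cube of the same half-side, so clamping leaves the endpoints of the
    rectangle fixed. *)
Lemma cubevol_sub y rho x e : (forall i, 0 <= e i) ->
  rect x e `<=` euclid_ball y rho -> cubevol y rho x e = \prod_i (2 * e i).
Proof.
move=> e0 sub; apply: eq_bigr => i _.
have h (s : R) : `|s| = 1 -> `|y 0 i - (x 0 i + s * e i)| <= rho.
  move=> s1; have : rect x e (\row_j (x 0 j + s * e j)).
    by move=> j; rewrite mxE addrC addKr normrM s1 mul1r ger0_norm.
  by move/sub; apply: le_trans; have := euclid_dist_coord y (\row_j (x 0 j + s * e j)) i; rewrite mxE.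
have := h 1 (normr1 _); have := h (-1); rewrite normrN normr1 => /(_ erefl).
rewrite !ler_norml mulN1r mul1r => /andP[? ?] /andP[? ?].
by rewrite !clamp_id; [ring|apply/andP; split; lra|apply/andP; split; lra].
Qed.

Variables (K : nat) (L : 'I_n -> nat).
Hypotheses (L_gt0 : forall i, (0 < L i)%N) (L_le : forall i, (L i <= K)%N).

(** The number of slabs depends on the direction; the common bound [K] makes the multi-indices a set
    of functions with a fixed codomain. *)
Definition tiles : {set {ffun 'I_n -> 'I_K}} := [set f : {ffun 'I_n -> 'I_K} | [forall i, (f i < L i)%N]].

Definition tile (x : 'rV[R]_n) (e : 'I_n -> R) (f : {ffun 'I_n -> 'I_K}) : 'rV[R]_n :=
  \row_i (x 0 i - e i + (2 * (f i)%:R + 1) * (e i / (L i)%:R)).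

Lemma tilesP (f : {ffun 'I_n -> 'I_K}) : reflect (forall i, (f i < L i)%N) (f \in tiles).
Proof. by rewrite inE; exact: forallP. Qed.

Lemma sum_tiles (g : 'I_n -> nat -> R) :
  \sum_(f in tiles) \prod_i g i (f i) = \prod_i \sum_(0 <= j < L i) g i j.
Proof.
transitivity (\prod_i \sum_(j < K | (j < L i)%N) g i j); last first.
  by apply: eq_bigr => i _; rewrite big_mkord (big_ord_widen _ _ (L_le i)).
rewrite (bigA_distr_big_dep (fun i (j : 'I_K) => (j < L i)%N) (fun i (j : 'I_K) => g i j)).
apply: eq_bigl => f; apply/tilesP/familyP => H i; exact: H.
Qed.

Lemma card_tiles : #|tiles|%:R = \prod_i (L i)%:R :> R.
Proof.
transitivity (\sum_(f in tiles) \prod_(i < n) (1 : R)).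
  by rewrite -sum1_card natr_sum; apply: eq_bigr => f _; rewrite big1_eq.
rewrite (sum_tiles (fun _ _ => 1)); apply: eq_bigr => i _.
by rewrite sumr_const_nat subn0.
Qed.

Lemma tile_sub x e f : (forall i, 0 <= e i) -> f \in tiles ->
  rect (tile x e f) (fun i => e i / (L i)%:R) `<=` rect x e.
Proof.
move=> e0 /tilesP fL y Hy i; have := Hy i; rewrite mxE.
set h := e i / _; have h0 : 0 <= h by rewrite divr_ge0.
have eE : e i = (L i)%:R * h by rewrite /h mulrCA mulfV ?mulr1 // pnatr_eq0 -lt0n.
have fL1 : (f i)%:R + 1 <= (L i)%:R :> R by rewrite natr1 ler_nat.
have f0 : 0 <= (f i)%:R :> R by [].
by rewrite eE !ler_norml => /andP[? ?]; apply/andP; split; nra.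
Qed.

Lemma tile_cover x e y : (forall i, 0 < e i) -> rect x e y ->
  exists2 f, f \in tiles & rect (tile x e f) (fun i => e i / (L i)%:R) y.
Proof.
move=> e0 Hy.
have /choice[j Hj] i : exists j : nat, (j < L i)%N /\
    `|y 0 i - (x 0 i - e i + (2 * j%:R + 1) * (e i / (L i)%:R))| <= e i / (L i)%:R.
  set h := e i / _; have L0 : 0 < (L i)%:R :> R by rewrite ltr0n.
  have h0 : 0 < h by rewrite divr_gt0.
  have h20 : 0 < 2 * h :> R by lra.
  have eE : e i = (L i)%:R * h by rewrite /h mulrCA mulfV ?mulr1 // pnatr_eq0 -lt0n.
  have := Hy i; rewrite ler_norml => /andP[y1 y2].
  have [||j jL /andP[j1 j2]] := @unit_slot R ((y 0 i - x 0 i + e i) / (2 * h)) (L i) (L_gt0 i).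
  - by rewrite divr_ge0 ?(ltW h20) //; lra.
  - by rewrite ler_pdivrMr //; move: y2; rewrite eE; lra.
  exists j; split => //; rewrite ler_norml.
  move: j1 j2; rewrite ler_pdivlMr // ler_pdivrMr // => j1 j2.
  by apply/andP; split; lra.
exists [ffun i => Ordinal (leq_trans (Hj i).1 (L_le i))].
  by apply/tilesP => i; rewrite ffunE /=; exact: (Hj i).1.
by move=> i; rewrite mxE ffunE /=; exact: (Hj i).2.
Qed.

(** Clamped endpoints telescope in each coordinate, which gives exact additivity over the tiles
    without any measure. *)
Lemma cubevol_tiles y rho x e :
  \sum_(f in tiles) cubevol y rho (tile x e f) (fun i => e i / (L i)%:R) =
  cubevol y rho x e.
Proof.
pose c i := clamp (y 0 i - rho) (y 0 i + rho).
pose p i (j : nat) := c i (x 0 i - e i + 2 * j%:R * (e i / (L i)%:R)).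
transitivity (\sum_(f in tiles) \prod_i (p i (f i).+1 - p i (f i))).
  apply: eq_bigr => f _; apply: eq_bigr => i _; rewrite mxE /p -natr1.
  by congr (c i _ - c i _); ring.
rewrite (sum_tiles (fun i j => p i j.+1 - p i j)); apply: eq_bigr => i _.
rewrite telescope_sumr //; congr (c i _ - c i _).
  by field; rewrite pnatr_eq0 -lt0n.
by rewrite mulr0 mul0r addr0.
Qed.

Lemma lebesgueRn_tiles_ge x e (T : {set {ffun 'I_n -> 'I_K}}) (A : set 'rV[R]_n) :
  (forall i, 0 < e i) -> T \subset tiles ->
  (forall f, f \in T -> rect (tile x e f) (fun i => e i / (L i)%:R) `<=` A) ->
  ((#|T|%:R * \prod_i (2 * (e i / (L i)%:R)))%:E <= lebesgueRn A)%E.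
Proof.
move=> e0 Tt TA; pose h i := e i / (L i)%:R.
have h0 i : 0 < h i by rewrite divr_gt0 // ltr0n.
pose lo (f : {ffun 'I_n -> 'I_K}) i := tile x e f 0 i - h i.
pose hi (f : {ffun 'I_n -> 'I_K}) i := tile x e f 0 i + h i.
apply: le_trans (lebesgueRn_ge (T := T) (lo := lo) (hi := hi) _ _ _).
- rewrite lee_fin [leRHS](eq_bigr (fun=> \prod_i (2 * h i))); last first.
    by move=> f _; apply: eq_bigr => i _; rewrite /hi /lo; ring.
  by rewrite sumr_const mulr_natl.
- by move=> f i _; rewrite /hi /lo; have := h0 i; lra.
- move=> f fT v Hv; apply: (TA f fT) => i; have := Hv i; rewrite /hi /lo.
  by move=> /andP[? ?]; rewrite ler_norml; apply/andP; split; rewrite -/(h i); lra.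
- move=> f g v _ _ Hf Hg; apply/ffunP => i.
  apply/val_inj => /=; have := Hf i; have := Hg i; rewrite /hi /lo !mxE -/(h i).
  move=> /andP[? ?] /andP[? ?]; have := h0 i.
  case: (ltngtP (f i) (g i)) => // fg ?.
  + have fg1 : (f i)%:R + 1 <= (g i)%:R :> R by rewrite natr1 ler_nat.
    by exfalso; nra.
  + have fg1 : (g i)%:R + 1 <= (f i)%:R :> R by rewrite natr1 ler_nat.
    by exfalso; nra.
Qed.

End Tiling.

Lemma common_denominator (R : realType) (n : nat) (r : 'I_n -> R) :
  (forall i, 0 < r i) -> (forall i, exists q : rat, r i = ratr q) ->
  exists (b : nat) (a : 'I_n -> nat), (0 < b)%N /\ forall i, r i = (a i)%:R / b%:R.
Proof.
move=> r0 /choice[q Hq].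
exists (\prod_i `|denq (q i)|)%N, (fun i => `|numq (q i)| * \prod_(j | j != i) `|denq (q j)|)%N.
have d0 i : (0 < `|denq (q i)|)%N by rewrite absz_gt0 denq_neq0.
split; first by rewrite prodn_gt0.
move=> i; set P := (\prod_(j < n | j != i) `|denq (q j)|)%N.
have -> : (\prod_j `|denq (q j)| = `|denq (q i)| * P)%N by rewrite (bigD1 i).
rewrite !natrM Hq /ratr.
have q0 : 0 < q i by rewrite -(ltr0q R) -Hq.
have -> : (numq (q i))%:~R = `|numq (q i)|%:R :> R.
  by rewrite natr_absz ger0_norm // ltW // numq_gt0.
have -> : (denq (q i))%:~R = `|denq (q i)|%:R :> R.
  by rewrite natr_absz ger0_norm // ltW // denq_gt0.
have P0 : P%:R != 0 :> R by rewrite pnatr_eq0 -lt0n prodn_gt0.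
by field; rewrite P0 /= pnatr_eq0 -lt0n d0.
Qed.

(** The gaps between consecutive [b * ln m] shrink like [b / m], so eventually every interval of
    length [e] contains such a number. *)
Lemma log_scale (R : realType) (b e : R) : 0 < b -> 0 < e ->
  exists C, forall c, C < c -> exists2 m : nat, (0 < m)%N & c <= b * ln m%:R <= c + e.
Proof.
move=> b0 e0; exists (b * - ln (e / b)) => c cC.
exists (Num.truncn (expR (c / b))).+1 => //.
set m := (_).+1; have E0 := expR_gt0 (c / b).
have /andP[m1 m2] := truncn_itv (ltW E0).
apply/andP; split.
  rewrite mulrC -ler_pdivrMr // -[leLHS]expRK ler_ln ?posrE // ?ltr0n //.
  exact: ltW.
have m0 : 0 < m%:R :> R by rewrite ltr0n.
have : expR (- (c / b)) <= e / b.
  rewrite -[leRHS]lnK ?posrE ?divr_gt0 // ler_expR lerNl.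
  by rewrite ler_pdivlMr // mulrC ltW.
have : ln m%:R <= c / b + expR (- (c / b)).
  have -> : m%:R = expR (c / b) * (m%:R * expR (- (c / b))) :> R.
    by rewrite mulrCA -expRD subrr expR0 mulr1.
  rewrite lnM ?posrE ?mulr_gt0 ?expR_gt0 // expRK lerD2l.
  apply: le_trans (_ : m%:R * expR (- (c / b)) - 1 <= _).
    have := @le_ln1Dx R (m%:R * expR (- (c / b)) - 1).
    rewrite [1 + _]addrC subrK; apply; rewrite ltrBrDr addNr.
    by rewrite mulr_gt0 // expR_gt0.
  rewrite lerBlDr.
  have : m%:R <= expR (c / b) + 1 by rewrite /m -natr1 lerD2r.
  move=> /(ler_wpM2r (ltW (expR_gt0 (- (c / b))))) /le_trans; apply.
  rewrite mulrDl -expRD subrr expR0 mul1r; lra.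
move=> h1 h2; have {h1}h3 : ln m%:R <= (c + e) / b by rewrite mulrDl; lra.
by rewrite mulrC -ler_pdivlMr.
Qed.

Section RationalScales.
Variables (R : realType) (n : nat) (r : 'I_n -> R).
Hypotheses (n_ge1 : (1 <= n)%N) (r_gt0 : forall i, 0 < r i)
  (r_sum1 : \sum_(i < n) r i = 1).
Variables (b : nat) (a : 'I_n -> nat).
Hypotheses (b_gt0 : (0 < b)%N) (r_ab : forall i, r i = (a i)%:R / b%:R).

(** As [b + a i = b * (1 + r i)], this integer equals [expR ((1 + r i) * (b * ln m))] for positive
    [m]. *)
Definition ratio (m : nat) (i : 'I_n) : nat := (m ^ (b + a i))%N.

Definition ratio_bound (m : nat) : nat := (\max_i ratio m i)%N.

Lemma ratio_gt0 m i : (0 < m)%N -> (0 < ratio m i)%N.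
Proof. by move=> m0; rewrite expn_gt0 m0. Qed.

Lemma ratio_le m i : (ratio m i <= ratio_bound m)%N.
Proof. exact: leq_bigmax. Qed.

Lemma expR_ln_nat (m k : nat) : (0 < m)%N -> expR (k%:R * ln m%:R) = (m ^ k)%:R :> R.
Proof. by move=> m0; rewrite expRM_natl lnK ?posrE ?ltr0n // natrX. Qed.

Lemma radius_ratio m i t : (0 < m)%N ->
  radius r i (t + b%:R * ln m%:R) = radius r i t / (ratio m i)%:R.
Proof.
move=> m0; rewrite radiusD; congr (_ * _).
rewrite /radius expRN -expR_ln_nat //; congr (expR _)^-1.
by rewrite r_ab natrD; field; rewrite pnatr_eq0 -lt0n.
Qed.

(* Tiles meeting an obstacle lie entirely in the neighbourhood of the hyperplane
   of the simplex lemma, so their number is bounded by its volume. *)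
Lemma lebesgue_dim_ge (cn eps c : R) (m : nat) : (0 < m)%N ->
  c = b%:R * ln m%:R ->
  abs_decaying r (@lebesgueRn R n) [set: 'rV[R]_n] (@affine_hyperplanes R n) cn (1 + rmin r) ->
  0 < cn -> d_star r <= c -> 3 * cn * expR (- ((1 + rmin r) * c)) < 1 -> 0 < eps ->
  ln 2 + 2 * c + l_star r <= - ln eps ->
  ((n%:R - - ln (1 - 3 * cn * expR (- ((1 + rmin r) * c))) / ((1 + rmin r) * c))%:E <=
     hausdorff_dim (Bad r eps))%E.
Proof.
move=> m0 cE dec cn0 dc q1 eps0 epsb.
have radc i s : radius r i (s + c) = radius r i s / (ratio m i)%:R.
  by rewrite cE radius_ratio.
have ds0 : 0 < d_star r by exact: d_star_gt0.
have c0 : 0 < c by lra.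
set q := 3 * _ * _ in q1 *.
have q0 : 0 < q by rewrite !mulr_gt0 // expR_gt0.
pose L := - ln (1 - q); pose bb := ln 2 + 2 * c + l_star r.
have L0 : 0 <= L by rewrite oppr_ge0 ln_le0 // gerBl ltW.
have expL : expR L = (1 - q)^-1 by rewrite /L expRN lnK // posrE subr_gt0.
pose t k : R := l_star r + k%:R * c.
have ls0 : 0 < l_star r by exact: l_star_gt0.
have t0 k : 0 <= t k by rewrite addr_ge0 ?mulr_ge0 // ltW.
have tS k : t k.+1 = t k + c by rewrite /t -natr1; ring.
pose K := ratio_bound m.
have Lg i : (0 < ratio m i)%N by exact: ratio_gt0.
have Lle i : (ratio m i <= K)%N by exact: ratio_le.
pose vol k := \prod_i (2 * radius r i (t k)).
have vol0 k : 0 < vol k by apply: prodr_gt0 => i _; rewrite mulr_gt0 // radius_gt0.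
pose N : R := \prod_i (ratio m i)%:R.
have volS k : vol k = N * vol k.+1.
  rewrite /vol /N -big_split /=; apply: eq_bigr => i _.
  by rewrite tS radc; field; rewrite pnatr_eq0 -lt0n.
have radS k : radius r ^~ (t k.+1) = fun i => radius r i (t k) / (ratio m i)%:R.
  by apply/funext => i; rewrite tS radc.
pose W (k : nat) (x : 'rV[R]_n) : \bar R := (expR (L * k%:R) * vol k)%:E.
pose M y rho k x : \bar R := (cubevol y rho x (radius r ^~ (t k)))%:E.
pose good (k : nat) x := away r bb (t k - l_star r - c) x (t k).
have rad0 k i : 0 < radius r i (t k) by exact: radius_gt0.
have rad0' k i : 0 <= radius r i (t k) by exact: ltW.
apply: (@hausdorff_dim_ge _ _ _ good (fun k x => box r x (t k)) W M 0
  (n%:R * (2 * expR (- ((1 + rmin r) * l_star r)))) L ((1 + rmin r) * c) n%:R (vol 0%N)) => //.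
- by rewrite mulr_gt0 ?ltr0n // mulr_gt0 // expR_gt0.
- by rewrite mulr_gt0 // addr_gt0 // rmin_gt0.
- move=> k x y z xy xz; apply: le_trans (box_diam (t0 k) xy xz) _.
  rewrite -!mulrA -expRD le_eqVlt; apply/orP; left; apply/eqP.
  by congr (_ * (_ * expR _)); rewrite /t; ring.
- by move=> y rho k x; rewrite lee_fin; apply: cubevol_ge0.
- rewrite /good /t mul0r addr0 subrr sub0r => y _ q' p q'0 lq.
  exfalso; have : 0 <= ln q'%:R :> R by rewrite ln_ge0 // ler1n.
  lra.
- by rewrite /W mulr0 expR0 mul1r.
- move=> k x aw.
  have [S HS Sch] := away_child n_ge1 r_gt0 r_sum1 (ltW c0) aw.
  pose e := radius r ^~ (t k).
  pose tl (f : {ffun 'I_n -> 'I_K}) := tile (ratio m) x e f.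
  pose T := tiles K (ratio m).
  pose B := [set f in T | `[< box r (tl f) (t k.+1) `<=` nbhd r S (t k + c - d_star r) >]]%SET.
  have tsub f : f \in T -> box r (tl f) (t k.+1) `<=` box r x (t k).
    by move=> fT; rewrite !box_rect radS; exact: (tile_sub Lg (rad0' k) fT).
  have BT : B \subset T by apply/fintype.subsetP => f; rewrite inE => /andP[].
  have Bcard : #|B|%:R <= q * N.
    have : ((#|B|%:R * \prod_i (2 * (e i / (ratio m i)%:R)))%:E <=
        (cn * expR (- ((1 + rmin r) * (c - d_star r))) * vol k)%:E)%E.
      have lt := @lebesgueRn_tiles_ge R n K (ratio m) Lg x e B
         (box r x (t k) `&` nbhd r S (t k + (c - d_star r))).
      apply: le_trans (lt _ BT _) _; first by move=> i; exact: rad0.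
        move=> f; rewrite inE => /andP[fT /asboolP fS] y fy.
        have fy' : box r (tl f) (t k.+1) y by rewrite box_rect radS.
        by split; [exact: tsub fy'|rewrite addrA; exact: fS].
      have s0 : 0 <= c - d_star r by rewrite subr_ge0.
      apply: le_trans (dec x (t k) S (c - d_star r) I HS s0) _.
      rewrite [X in (_ <= X)%E]EFinM; apply: lee_wpmul2l.
        by rewrite lee_fin mulr_ge0 ?expR_ge0 // ltW.
      by rewrite box_rect; apply: lebesgueRn_rect_le.
    rewrite lee_fin (_ : \prod_i _ = vol k.+1); last first.
      by apply: eq_bigr => i _; rewrite tS radc.
    rewrite (volS k) mulrA ler_pM2r //.
    (* The factor 3 in [q] is [expR ((1 + rmin) * d_star)], the price of using decay with
       [s = c - d_star]. *)
    rewrite (_ : cn * _ = q) // /q -mulrA mulrCA; congr (_ * _).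
    rewrite mulrBr opprB expRD; congr (_ * _).
    rewrite /d_star mulrCA mulfV ?mulr1 ?lnK ?posrE // gt_eqF // addr_gt0 // rmin_gt0 //.
  exists [seq tl f | f <- enum (T :\: B)]; split.
  + move=> y /mapP[f]; rewrite mem_enum inE => /andP[fB fT] ->.
    split; last exact: tsub.
    rewrite /good tS (_ : t k + c - l_star r - c = t k - l_star r); last ring.
    apply: Sch; first by rewrite -tS; exact: tsub.
    by move=> H; case/negP: fB; rewrite inE fT; apply/asboolP; rewrite tS.
  + rewrite big_map big_enum /W sumEFin sumr_const lee_fin.
    have -> : expR (L * k.+1%:R) = expR (L * k%:R) * (1 - q)^-1.
      by rewrite -natr1 mulrDr mulr1 expRD expL.
    rewrite -[leRHS]mulr_natl (volS k).
    rewrite (_ : #|T :\: B|%:R = N - #|B|%:R); last first.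
      rewrite cardsD (finset.setIidPr BT) natrB ?subset_leq_card //.
      by rewrite /T card_tiles.
    rewrite (_ : _ * (_ * vol k.+1) = expR (L * k%:R) * vol k.+1 * N); last by ring.
    rewrite (_ : _ * (_ * vol k.+1) = expR (L * k%:R) * vol k.+1 * ((N - #|B|%:R) / (1 - q))); last by ring.
    rewrite ler_wpM2l ?mulr_ge0 ?expR_ge0 ?(ltW (vol0 _)) //.
    rewrite ler_pdivlMr ?subr_gt0 //; lra.
  + move=> y rho; rewrite big_map big_enum /M sumEFin lee_fin radS.
    rewrite -(cubevol_tiles Lg Lle y rho x) -/T.
    rewrite [leRHS](big_setID B) /= (finset.setIidPr BT) lerDr.
    by apply: sumr_ge0 => f _; apply: cubevol_ge0 => i; rewrite divr_ge0.
- move=> k x y rho _ sub; rewrite /W /M -EFinM lee_fin ler_wpM2l ?expR_ge0 //.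
  by rewrite cubevol_sub // -box_rect.
- move=> y _ d' d'n.
  (* Below this threshold [2 ^ n * rho ^ (n - d') <= 1], that is, [(2 * rho) ^ n <= rho ^ d']. *)
  pose s := (n%:R - d')^-1.
  exists (((2 ^ n)%:R^-1 : R) `^ s); split; first by rewrite powR_gt0 // invr_gt0 ltr0n expn_gt0.
  move=> rho rho0 rhos; rewrite /M lee_fin.
  apply: le_trans (cubevol_le _ _ (ltW rho0) (rad0' 0%N)) _.
  have : rho `^ (n%:R - d') <= (2 ^ n)%:R^-1.
    have -> : ((2 ^ n)%:R^-1 : R) = ((2 ^ n)%:R^-1 `^ s) `^ (n%:R - d').
      by rewrite -powRrM /s mulVf ?powRr1 ?invr_ge0 // subr_eq0 gt_eqF.
    apply: ge0_ler_powR; rewrite ?nnegrE ?powR_ge0 ?subr_ge0 ?(ltW d'n) ?(ltW rho0) ?(ltW rhos) //.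
  rewrite exprMn -natrX -powR_mulrn ?(ltW rho0) // => H.
  have -> : rho `^ n%:R = rho `^ (n%:R - d') * rho `^ d'.
    by rewrite -powRD ?subrK // (gt_eqF rho0) implybT.
  rewrite mulrA ler_piMl ?powR_ge0 //.
  by rewrite -ler_pdivlMl ?mulr1 // ltr0n expn_gt0.
- move=> u gu nest; have [z Hz] := nested_boxes (t := t) nest.
  exists z; split => //.
  apply: (Bad_of_away r_gt0 eps0 epsb) => k.
  pose k' := (Num.truncn (k%:R / c)).+2.
  exists (t k' - l_star r - c), (u k'), (t k'); split => //; last exact: gu.
  have : k%:R / c <= (Num.truncn (k%:R / c)).+1%:R by rewrite ltW // truncnS_gt.
  rewrite ler_pdivrMr // /k' /t -[in X in _ -> X]natr1; lra.
Qed.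

End RationalScales.

(** * Dirichlet's theorem and the upper bound *)

(** Pigeonhole: the fractional parts of [j * z] for [j] from 0 to [M ^ b] fall into [M ^ b] tiles of
    the unit cube with sides [1 / M ^ a i]; two that share a tile are subtracted. *)
Lemma dirichlet_weighted (R : realType) (n : nat) (z : 'rV[R]_n) (M b : nat)
    (a : 'I_n -> nat) : (0 < M)%N -> (\sum_i a i = b)%N ->
  exists (q : nat) (p : 'I_n -> int), [/\ (0 < q)%N, (q <= M ^ b)%N &
    forall i, `|q%:R * z 0 i - (p i)%:~R| <= (M ^ a i)%:R^-1].
Proof.
move=> M0 ab; pose L i := (M ^ a i)%N; pose K := (M ^ b)%N.
have L0 i : (0 < L i)%N by rewrite expn_gt0 M0.
have LK i : (L i <= K)%N.
  by rewrite leq_pexp2l // -ab (bigD1 i) //= leq_addr.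
have cT : #|tiles K L| = K.
  apply/eqP; rewrite -(eqr_nat R) (card_tiles R LK) -natr_prod eqr_nat.
  by rewrite /L -expn_sum ab.
pose fr (j : nat) : 'rV[R]_n := \row_i (j%:R * z 0 i - (Num.floor (j%:R * z 0 i))%:~R).
(* The unit cube as the rectangle with centre and half-sides 1/2. *)
pose e : 'I_n -> R := fun=> 2^-1; pose x : 'rV[R]_n := const_mx 2^-1.
have e0 i : 0 < e i by rewrite invr_gt0.
have /choice[F HF] (j : 'I_K.+1) : exists f, f \in tiles K L /\
    rect (tile L x e f) (fun i => e i / (L i)%:R) (fr j).
  have [|f fT Hf] := @tile_cover R n K L L0 LK x e (fr j) e0; last by exists f.
  move=> i; rewrite !mxE /e; have := floor_itv (j%:R * z 0 i).
  rewrite intrD => /andP[h1 h2]; rewrite ler_norml; apply/andP; split; lra.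
have [j1 [j2 [j12 FE]]] : exists j1 j2 : 'I_K.+1, (j1 < j2)%N /\ F j1 = F j2.
  have /injectivePn[j [j' jj' FE]] : ~~ injectiveb F.
    apply/negP => /injectiveP injF.
    have : (#|[set F j | j in [set: 'I_K.+1]]%SET| <= #|tiles K L|)%N.
      apply: subset_leq_card; apply/fintype.subsetP => f /imsetP[j _ ->].
      exact: (HF j).1.
    by rewrite cT card_imset // cardsT card_ord ltnn.
  move: jj'; rewrite neq_ltn => /orP[lt|lt]; first by exists j, j'.
  by exists j', j.
exists (j2 - j1)%N, (fun i => Num.floor (j2%:R * z 0 i) - Num.floor (j1%:R * z 0 i)); split.
- by rewrite subn_gt0.
- by apply: leq_trans (leq_subr _ _) _; rewrite -ltnS.
- move=> i; have := (HF j1).2 i; have := (HF j2).2 i; rewrite FE !mxE /e /L.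
  rewrite natrB ?(ltnW j12) // intrD intrN.
  set h := ((M ^ a i)%:R^-1 : R); rewrite !ler_norml => /andP[? ?] /andP[? ?].
  by apply/andP; split; lra.
Qed.

(** The list is padded by empty sets, which cost [0 ^ s = 0] because [s > 0]. *)
Lemma finite_cover_null (R : realType) (n : nat) (s d : R) (A : set 'rV[R]_n) :
  0 < s -> 0 < d ->
  (forall e, 0 < e -> exists (l : seq (set 'rV[R]_n)) (D : R),
     [/\ 0 <= D, D <= d, (size l)%:R * D `^ s <= e,
         forall U, U \in l -> (ediam U <= D%:E)%E &
         forall x, A x -> exists2 U, U \in l & U x]) ->
  hausdorff_content s d A = 0%E.
Proof.
move=> s0 d0 H; apply: hausdorff_content_null => e e0.
have [l [D [D0 Dd lD lU cov]]] := H e e0.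
have ediam0 : ediam (set0 : set 'rV[R]_n) = 0%E.
  by apply/eqP; rewrite eq_le ediam_ge0 andbT; apply: ediam_le.
exists (nth set0 l); split.
- move=> x /cov[U Ul Ux]; exists (index U l) => //.
  by rewrite nth_index.
- move=> k; have [kl|kl] := ltnP k (size l).
    by apply: le_trans (lU _ (mem_nth _ kl)) _; rewrite lee_fin.
  by rewrite nth_default // ediam0 lee_fin ltW.
- rewrite (nneseries_split 0 (size l)); last by move=> k _; exact: poweR_ge0.
  rewrite [X in (_ + X)%E](_ : _ = 0%E) ?adde0; last first.
    rewrite add0n; apply: (@eseries0 _ _ (size l)) => k kl _.
    by rewrite nth_default // ediam0 poweR0r // gt_eqF.
  apply: le_trans (_ : ((size l)%:R * D `^ s)%:E <= _)%E; last by rewrite lee_fin.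
  rewrite add0n big_mkord; apply: (@le_trans _ _ (\sum_(i < size l) (D `^ s)%:E)%E).
    apply: lee_sum => i _; rewrite -poweR_EFin.
    apply: gt0_ler_poweR; first exact: ltW.
    + by rewrite in_itv /= ediam_ge0 leey.
    + by rewrite in_itv /= lee_fin D0 leey.
    + by apply: lU; exact: mem_nth.
  by rewrite sumEFin sumr_const card_ord mulr_natl.
Qed.

Section UpperBound.
Variables (R : realType) (n : nat) (r : 'I_n -> R).
Hypotheses (n_ge1 : (1 <= n)%N) (r_gt0 : forall i, 0 < r i)
  (r_sum1 : \sum_(i < n) r i = 1).
Variables (b : nat) (a : 'I_n -> nat).
Hypotheses (b_gt0 : (0 < b)%N) (r_ab : forall i, r i = (a i)%:R / b%:R).
Variables (m m' : nat) (c c' u w : R).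
Hypotheses (m_gt0 : (0 < m)%N) (m'_gt0 : (0 < m')%N)
  (c'E : c' = b%:R * ln m%:R) (wE : w = b%:R * ln m'%:R)
  (c_ge0 : 0 <= c) (w_le : w <= u) (c'_ge : c + u + ln 2 <= c') (u_ge : ln 2 <= u)
  (w_ge : forall i, c + c / rmin r + 2 * ln 2 <= (1 + r i) * w).

Let K := ratio_bound b a m.
Let Lr := ratio b a m.

Lemma sum_a : (\sum_i a i = b)%N.
Proof.
apply/eqP; rewrite -(eqr_nat R) natr_sum; apply/eqP.
have := r_sum1; rewrite (eq_bigr _ (fun i _ => r_ab i)) -mulr_suml => /eqP.
by rewrite -[X in _ == X](@divff _ b%:R) ?pnatr_eq0 -?lt0n // => /eqP/(divIf _) ->;
  rewrite ?pnatr_eq0 -?lt0n.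
Qed.

Lemma radius_c' i s : radius r i (s + c') = radius r i s / (Lr i)%:R.
Proof. by rewrite c'E (radius_ratio b_gt0 r_ab). Qed.

Lemma ratio_pos i : (0 < Lr i)%N. Proof. exact: ratio_gt0. Qed.
Lemma ratio_bounded i : (Lr i <= K)%N. Proof. exact: ratio_le. Qed.

(* If the middle half of the box contains a badly approximable point, Dirichlet's
   theorem for that point produces a rational in the box whose own neighbourhood
   contains a whole tile. *)
Lemma tile_without_Bad (k : nat) (x : 'rV[R]_n) :
  exists2 f, f \in tiles K Lr &
    forall y, rect (tile Lr x (radius r ^~ (k%:R * c')) f)
      (fun i => radius r i (k%:R * c') / (Lr i)%:R) y -> ~ Bad r (expR (- c)) y.
Proof.
pose t := k%:R * c'; pose e := radius r ^~ t.
have e0 i : 0 < e i by exact: radius_gt0.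
have half i s : 2 * radius r i (s + ln 2) < radius r i s.
  by rewrite radiusD; have := radius_gt0 r i s; have := radius_ln2_lt r_gt0 i; nra.
have small i : 4 * (e i / (Lr i)%:R) <= e i.
  rewrite -radius_c'; have h1 := half i t; have h2 := half i (t + ln 2).
  apply: le_trans (_ : 4 * radius r i (t + ln 2 + ln 2) <= _).
    rewrite ler_wpM2l //; apply: radius_le => //.
    rewrite -addrA lerD2l.
    apply: le_trans c'_ge; rewrite lerD2r; apply: le_trans u_ge _.
    by rewrite lerDr.
  by rewrite /e; lra.
(* Without a badly approximable point in the middle half, the tile containing the centre will do:
   its half-sides are at most a quarter of the box's, so it stays in the middle half. *)
have [[z [zx Bz]]|noz] := pselect (exists z : 'rV[R]_n,
    (forall i, `|z 0 i - x 0 i| <= 2^-1 * e i) /\ Bad r (expR (- c)) z); last first.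
  have [|f fT xf] := @tile_cover R n K Lr ratio_pos ratio_bounded x e x e0.
    by move=> i; rewrite subrr normr0 ltW.
  exists f => // y yf By; apply: noz; exists y; split => // i.
  have := yf i; have := xf i; have := small i; rewrite -/(e i).
  move: (tile _ _ _ _ _ _) (e i / _) => v h; rewrite !ler_norml => ? /andP[? ?] /andP[? ?].
  by apply/andP; split; lra.
(* With this [M] the bound of Dirichlet's theorem is [M ^ b = expR (t + w)]. *)
pose M := (m ^ k * m')%N; pose T := t + w.
have M0 : (0 < M)%N by rewrite muln_gt0 expn_gt0 m_gt0.
have lnM : b%:R * ln M%:R = T.
  rewrite /M natrM lnM ?posrE ?ltr0n ?expn_gt0 ?m_gt0 // natrX lnXn ?ltr0n //.
  by rewrite mulrDr /T /t c'E wE -mulr_natl; ring.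
have [q [p [q0 qM pq]]] := dirichlet_weighted z M0 sum_a.
have q0' : 0 < q%:R :> R by rewrite ltr0n.
have lnq : ln q%:R <= T.
  rewrite -lnM mulr_natl -lnXn ?ltr0n // -natrX ler_ln ?posrE ?ltr0n ?expn_gt0 ?M0 //.
  by rewrite ler_nat.
have approx i : `|z 0 i - (p i)%:~R / q%:R| <= expR (- (r i * T + ln q%:R)).
  have -> : z 0 i - (p i)%:~R / q%:R = (q%:R * z 0 i - (p i)%:~R) / q%:R.
    by field; rewrite gt_eqF.
  rewrite normrM normfV (gtr0_norm q0') ler_pdivrMr //.
  rewrite opprD expRD -mulrA [X in _ <= _ * X](_ : _ = 1) ?mulr1; last first.
    by rewrite expRN lnK ?posrE // mulVf // gt_eqF.
  apply: le_trans (pq i) _; rewrite -expR_ln_nat // -expRN ler_expR lerN2.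
  rewrite -lnM r_ab mulrA divfK // pnatr_eq0 -lt0n //.
have [i0] := Bz q p q0.
rewrite powR_radius ?expR_gt0 // expRK opprK => /le_trans/(_ (approx i0)).
rewrite /radius ler_expR lerN2 => Hi0.
(* [Bad] and Dirichlet in coordinate [i0] give [r * T + ln q <= (1 + r) * (ln q + c)] with
   [r = r i0], to be solved for [ln q]. *)
have lnq' : T - c - c / rmin r <= ln q%:R.
  have r0 := r_gt0 i0; have rm0 := rmin_gt0 r_gt0.
  have : c / r i0 <= c / rmin r by rewrite ler_wpM2l // lef_pV2 ?posrE // rmin_le.
  have : T - c - c / r i0 <= ln q%:R.
    rewrite -(ler_pM2l r0) !mulrBr [r i0 * (c / _)]mulrCA mulfV ?gt_eqF // mulr1; lra.
  lra.
(* By [w_ge], the lower bound on [ln q] yields [r i * T + ln q >= (1 + r i) * t + 2 * ln 2]; the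
   [2 * ln 2] is the factor 1/4. *)
have zv i : `|z 0 i - ratpt R q p 0 i| <= 4^-1 * e i.
  rewrite mxE; apply: le_trans (approx i) _.
  have -> : 4^-1 = expR (- (2 * ln 2)) :> R.
    by rewrite expRN expRM_natl lnK ?posrE // -natrX.
  rewrite /e /radius -expRD ler_expR; have := w_ge i; rewrite /T in lnq' *.
  by have := r_gt0 i; nra.
have [|f fT vf] := @tile_cover R n K Lr ratio_pos ratio_bounded x e (ratpt R q p) e0.
  move=> i; have := zv i; have := zx i; have := e0 i; rewrite !ler_norml.
  by move=> ? /andP[? ?] /andP[? ?]; apply/andP; split; lra.
exists f => // y yf By; have [i] := By q p q0.
rewrite powR_radius ?expR_gt0 // expRK opprK leNgt => /negP; apply.
have near : `|y 0 i - ratpt R q p 0 i| <= 2 * (e i / (Lr i)%:R).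
  have := yf i; have := vf i; rewrite -/(e i).
  move: (tile _ _ _ _ _ _) (e i / _) => v h; rewrite !ler_norml => /andP[? ?] /andP[? ?].
  by apply/andP; split; lra.
rewrite mxE in near; apply: le_lt_trans near _; rewrite -radius_c'.
(* Since [ln q <= t + u], the hypothesis on [c'] makes [t + c'] at least [ln q + c + ln 2], so the
   tile fits strictly inside the forbidden neighbourhood of the rational. *)
apply: (@le_lt_trans _ _ (2 * radius r i (ln q%:R + c + ln 2))); last exact: half.
rewrite ler_wpM2l //; apply: radius_le => //; rewrite /T in lnq.
have h : ln q%:R <= t + u by apply: le_trans lnq _; rewrite lerD2l.
apply: le_trans (_ : t + (c + u + ln 2) <= _); last by rewrite lerD2l.
lra.
Qed.

Lemma Bad_cover_count (k : nat) (x0 : 'rV[R]_n) :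
  exists2 s : seq 'rV[R]_n, (size s <= (#|tiles K Lr|.-1) ^ k)%N &
    forall y, Bad r (expR (- c)) y -> box r x0 0 y ->
      exists2 x, x \in s & box r x (k%:R * c') y.
Proof.
elim: k => [|k [s ss sP]].
  by exists [:: x0] => // y _ yx; exists x0; rewrite ?mem_head // mul0r.
have /choice[g Hg] x : exists f, f \in tiles K Lr /\
    forall y, rect (tile Lr x (radius r ^~ (k%:R * c')) f)
      (fun i => radius r i (k%:R * c') / (Lr i)%:R) y -> ~ Bad r (expR (- c)) y.
  by have [f fT Hf] := tile_without_Bad k x; exists f.
exists [seq tile Lr x (radius r ^~ (k%:R * c')) f | x <- s, f <- enum (tiles K Lr :\ g x)].
  rewrite size_allpairs_dep expnSr.
  rewrite (eq_map (g := fun=> #|tiles K Lr|.-1)).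
    by rewrite sumnE big_map big_const_seq count_predT iter_addn_0 mulnC leq_mul2r ss orbT.
  by move=> x; rewrite -cardE [in RHS](cardsD1 (g x)) (Hg x).1.
move=> y By yx0; have [x xs] := sP y By yx0; rewrite box_rect => yx.
have [f fT yf] := @tile_cover R n K Lr ratio_pos ratio_bounded x _ y
  (fun i => radius_gt0 r i (k%:R * c')) yx.
exists (tile Lr x (radius r ^~ (k%:R * c')) f).
  apply/allpairsPdep; exists x, f; split => //.
  rewrite mem_enum in_setD1 fT andbT; apply/eqP => fg.
  by apply: (Hg x).2 By; rewrite -fg.
apply/boxP => i; have -> : k.+1%:R * c' = k%:R * c' + c' by rewrite -natr1; ring.
by rewrite radius_c'; exact: yf.
Qed.

Lemma card_tiles_expR : #|tiles K Lr|%:R = expR (n.+1%:R * c') :> R.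
Proof.
rewrite (card_tiles R ratio_bounded) -[X in expR X]opprK expRN -(prod_radius r_sum1).
rewrite -prodfV; apply: eq_bigr => i _.
rewrite -[c']add0r radius_c' /radius mulr0 oppr0 expR0 mul1r invrK //.
Qed.

(** Cutting the boxes of level [k] into cubes of their shortest side gives a cover of cost [expR (-
    (kappa - (n - s) * (1 + rmax) * c') * k)] up to a constant, which tends to 0 by hypothesis. *)
Lemma Bad_box_null (s d : R) (x0 : 'rV[R]_n) : 0 < s -> 0 < d ->
  (n%:R - s) * ((1 + rmax r) * c') < - ln (1 - (#|tiles K Lr|%:R)^-1) ->
  hausdorff_content s d (Bad r (expR (- c)) `&` box r x0 0) = 0%E.
Proof.
move=> s0 d0; rewrite card_tiles_expR; set kappa := - ln _ => xi0.
have c'0 : 0 < c'.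
  have l2 : 0 < ln 2 :> R by rewrite ln_gt0 // ltr1n.
  have u0 : 0 <= u by exact: le_trans (ltW l2) u_ge.
  by apply: (lt_le_trans _ c'_ge); apply: ltr_wpDl => //; exact: addr_ge0.
have N1 : 1 < expR (n.+1%:R * c') :> R by rewrite expR_gt1 mulr_gt0.
have NV : 0 < 1 - (expR (n.+1%:R * c'))^-1 by rewrite subr_gt0 invf_lt1 ?expR_gt0.
have NB : expR (n.+1%:R * c') - 1 = expR (n.+1%:R * c' - kappa).
  by rewrite expRD /kappa opprK lnK ?posrE // mulrBr mulr1 mulfV // gt_eqF ?expR_gt0.
have [ip ipE] := rmax_attained n_ge1 r_gt0.
have aip i : (a i <= a ip)%N.
  have b0 : 0 < b%:R :> R by rewrite ltr0n.
  have := rmax_ge r i; rewrite ipE !r_ab ler_pM2r ?invr_gt0 //.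
  by rewrite ler_nat.
have rip0 : 0 < 1 + rmax r by rewrite ipE addr_gt0.
pose E (k : nat) : R := expR (- ((1 + rmax r) * (k%:R * c'))).
(* The side ratio is an integer because [b * (rmax - r i) = a ip - a i], so the cubes tile the box
   exactly. *)
pose L' (k : nat) i := (m ^ ((a ip - a i) * k))%N.
have L'0 k i : (0 < L' k i)%N by rewrite expn_gt0 m_gt0.
have L'E k i : radius r i (k%:R * c') / (L' k i)%:R = E k.
  rewrite /L' -expR_ln_nat // -expRN /radius /E -expRD; congr expR.
  rewrite ipE !r_ab natrM natrB // c'E; field.
  by rewrite pnatr_eq0 -lt0n.
pose xi := kappa - (n%:R - s) * ((1 + rmax r) * c').
have xi_gt0 : 0 < xi by rewrite subr_gt0.
pose C := (n%:R * 2) `^ s + n%:R * 2.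
have n0 : 0 < n%:R * 2 :> R by rewrite mulr_gt0 // ltr0n.
have Cs0 : 0 < (n%:R * 2 : R) `^ s by exact: powR_gt0.
have C0 : 0 < C by rewrite addr_gt0.
apply: finite_cover_null => // e e0.
(* The smaller of the decay rates of cost and diameter; with both constants summed in [C], one level
   makes both small. *)
pose mu := Num.min xi ((1 + rmax r) * c').
have mu0 : 0 < mu by rewrite lt_min xi_gt0 mulr_gt0.
pose dl := Num.min (Num.min e d) 1.
have dl0 : 0 < dl by rewrite !lt_min e0 d0 ltr01.
have dl1 : dl <= 1 by rewrite ge_min lexx orbT.
have [k [Ck _]] := exists_level C0 mu0 dl0 dl1.
have dle : dl <= e by rewrite !ge_min lexx.
have dld : dl <= d by rewrite !ge_min lexx orbT.
have k0 : 0 <= k%:R :> R by [].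
have [t ts tP] := Bad_cover_count k x0.
pose K' := (\max_i L' k i)%N.
have L'K i : (L' k i <= K')%N by exact: leq_bigmax.
pose cb := [seq tile (L' k) x (radius r ^~ (k%:R * c')) f | x <- t, f <- enum (tiles K' (L' k))].
exists [seq rect y (fun=> E k) | y <- cb], (n%:R * (2 * E k)); split.
- by rewrite !mulr_ge0 // expR_ge0.
- apply: le_trans dld; apply: le_trans Ck; rewrite mulrA; apply: ler_pM.
  + exact: ltW.
  + exact: expR_ge0.
  + by rewrite lerDr ltW.
  + rewrite /E ler_expR lerN2.
    have -> : (1 + rmax r) * (k%:R * c') = (1 + rmax r) * c' * k%:R by ring.
    by rewrite ler_wpM2r // ge_min lexx orbT.
- rewrite size_map size_allpairs -cardE.
  have sz : (size t * #|tiles K' (L' k)|)%:R <=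
      expR (k%:R * (n.+1%:R * c' - kappa)) *
      (expR (- (n.+1%:R * (k%:R * c'))) * expR (n%:R * ((1 + rmax r) * (k%:R * c')))).
    rewrite natrM; apply: ler_pM => //.
      rewrite expRM_natl -NB -card_tiles_expR.
      have := ts; rewrite -(ler_nat R) natrX -subn1 natrB //.
      by rewrite -(ltr_nat R) card_tiles_expR; apply: lt_trans N1.
    rewrite (card_tiles R L'K) -(prod_radius r_sum1) expRM_natl -[X in _ ^+ X]card_ord.
    rewrite -prodr_const -big_split /=; apply: ler_prod => i _; rewrite ler0n /=.
    rewrite -[X in _ * X]invrK -expRN -/(E k) -(L'E k i) invf_div mulrCA mulfV ?mulr1 //.
    by rewrite gt_eqF // radius_gt0.
  apply: le_trans dle; apply: le_trans Ck.
  apply: le_trans (ler_wpM2r (powR_ge0 _ _) sz) _.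
  have -> : (n%:R * (2 * E k)) `^ s =
      (n%:R * 2) `^ s * expR (- ((1 + rmax r) * (k%:R * c')) * s).
    by rewrite expRM -powRM ?expR_ge0 ?(ltW n0) // mulrA.
  rewrite [leLHS]mulrC -mulrA -!expRD; apply: ler_pM; rewrite ?expR_ge0 ?(ltW Cs0) //.
    by rewrite /C lerDl ltW.
  rewrite ler_expR.
  have : mu * k%:R <= xi * k%:R by rewrite ler_wpM2r // ge_min lexx.
  rewrite /xi => h; apply: le_trans (_ : - (kappa - (n%:R - s) * ((1 + rmax r) * c')) * k%:R <= _).
    by rewrite le_eqVlt; apply/orP; left; apply/eqP; ring.
  by rewrite mulNr lerN2.
- move=> U /mapP[y _ ->]; apply: ediam_le; first by rewrite !mulr_ge0 // expR_ge0.
  move=> u' v Hu Hv; apply: euclid_dist_le; first by rewrite mulr_ge0 // expR_ge0.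
  move=> i; have := Hu i; have := Hv i; rewrite !ler_norml => /andP[? ?] /andP[? ?].
  by apply/andP; split; lra.
- move=> y [By yx0]; have [x xt] := tP y By yx0; rewrite box_rect => yx.
  have [f fT yf] := @tile_cover R n K' (L' k) (L'0 k) L'K x _ y
    (fun i => radius_gt0 r i (k%:R * c')) yx.
  exists (rect (tile (L' k) x (radius r ^~ (k%:R * c')) f) (fun=> E k)).
    apply/mapP; exists (tile (L' k) x (radius r ^~ (k%:R * c')) f) => //.
    by apply/allpairsP; exists (x, f); rewrite mem_enum.
  by move=> i; rewrite -(L'E k i); exact: yf.
Qed.

Lemma Bad_dim_le (s : R) : 0 < s ->
  (n%:R - s) * ((1 + rmax r) * c') < - ln (1 - (#|tiles K Lr|%:R)^-1) ->
  (hausdorff_dim (Bad r (expR (- c))) <= s%:E)%E.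
Proof.
move=> s0 hs; apply: ereal_inf_lbound; exists s => //; split => //.
apply: hausdorff_measure_null => d d0.
pose A (j : nat) : set 'rV[R]_n := if unpickle j is Some z then
  Bad r (expR (- c)) `&` box r (map_mx intr (z : 'rV[int]_n)) 0 else set0.
have -> : Bad r (expR (- c)) = \bigcup_j A j.
  apply/seteqP; split => [y By|y [j _]]; last by rewrite /A; case: unpickle => // z [].
  exists (pickle (\row_i Num.floor (y 0 i) : 'rV[int]_n)) => //.
  rewrite /A pickleK; split => //; apply/boxP => i; rewrite !mxE /radius mulr0 oppr0 expR0.
  have := floor_itv (y 0 i); rewrite intrD => /andP[h1 h2].
  by rewrite ler_norml; apply/andP; split; lra.
apply: hausdorff_content_bigcup_null => j; rewrite /A; case: unpickle => [z|].
  exact: Bad_box_null.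
apply: finite_cover_null => // e e0; exists [::], 0; split => //; first exact: ltW.
by rewrite mul0r ltW.
Qed.

End UpperBound.

(** * Rational weights *)

Section RationalWeights.
Variables (R : realType) (n : nat) (r : 'I_n -> R).
Hypotheses (n_ge1 : (1 <= n)%N) (r_gt0 : forall i, 0 < r i)
  (r_sum1 : \sum_(i < n) r i = 1) (r_rat : forall i, exists q : rat, r i = ratr q).

(** The step is rounded up to some [c' = b * ln m] between [c] and [c + d_star / 2], so that
    [2 * c' <= 2 * c + d_star]; this is the extra [d_star] in the statement. *)
Lemma rational_dim_ge (cn : R) : 0 < cn ->
  abs_decaying r (@lebesgueRn R n) [set: 'rV[R]_n]
    (@affine_hyperplanes R n) cn (1 + rmin r) ->
  exists c0, forall c, c0 < c ->
    ((n%:R - `|ln (1 - 18 * cn * expR (- ((1 + rmin r) * c)))| /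
             ((1 + rmin r) * c))%:E <=
     hausdorff_dim (Bad r (2^-1 * expR (- (2 * c + l_star r + d_star r)))))%E.
Proof.
move=> cn0 dec; have [b [a [b0 ab]]] := common_denominator r_gt0 r_rat.
have ds0 : 0 < d_star r by exact: d_star_gt0.
have b0' : 0 < b%:R :> R by rewrite ltr0n.
have [C HC] := log_scale b0' (divr_gt0 ds0 (ltr0n R 2)).
(* [c > ln (18 * cn)] keeps the argument of the logarithm positive, and [c > d_star] allows the
   decay estimate. *)
exists (`|C| + `|ln (18 * cn)| + d_star r) => c cgt.
have cC : C < c by have := ler_norm C; have := normr_ge0 (ln (18 * cn)); lra.
have cl : ln (18 * cn) < c.
  by have := ler_norm (ln (18 * cn)); have := normr_ge0 C; lra.
have dc : d_star r < c by have := normr_ge0 (ln (18 * cn)); have := normr_ge0 C; lra.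
have c0 : 0 < c by lra.
have rm0 := rmin_gt0 r_gt0.
have kap0 : 0 < 1 + rmin r by lra.
have [m m0 /andP[c1 c2]] := HC c cC.
pose c' : R := b%:R * ln m%:R; rewrite -/c' in c1 c2.
have c'0 : 0 < c' by lra.
have cn18 : 0 < 18 * cn by rewrite mulr_gt0.
set q18 := 18 * cn * expR _.
have q18_0 : 0 < q18 by rewrite mulr_gt0 // expR_gt0.
have q18_1 : q18 < 1.
  rewrite /q18 -[X in X * _]lnK ?posrE // -expRD -[ltRHS]expR0 ltr_expR.
  by have := mulr_gt0 rm0 c0; nra.
pose q3 := 3 * cn * expR (- ((1 + rmin r) * c')).
have q3_0 : 0 < q3 by rewrite !mulr_gt0 // expR_gt0.
have q3_le : q3 <= q18.
  apply: ler_pM; rewrite ?expR_ge0 ?mulr_ge0 ?(ltW cn0) //; first by lra.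
  by rewrite ler_expR lerN2 ler_wpM2l // ltW.
have e0 : 0 < 2^-1 * expR (- (2 * c + l_star r + d_star r)) by rewrite mulr_gt0 // expR_gt0.
apply: le_trans (lebesgue_dim_ge n_ge1 r_gt0 r_sum1 b0 ab m0 (erefl c') dec cn0 _ _ e0 _).
- rewrite lee_fin lerD2l lerN2 -/q3.
  have h18 : `|ln (1 - q18)| = - ln (1 - q18) by rewrite ler0_norm // ln_le0 // gerBl ltW.
  rewrite h18; apply: ler_pM.
  + by rewrite oppr_ge0 ln_le0 // gerBl ltW.
  + by rewrite invr_ge0 mulr_ge0 // ltW.
  + rewrite lerN2 ler_ln ?posrE ?subr_gt0 //; last exact: le_lt_trans q18_1.
    by rewrite lerD2l lerN2.
  + by have := ler_wpM2l (ltW kap0) c1; rewrite -lef_pV2 ?posrE ?(mulr_gt0 kap0).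
- by lra.
- exact: le_lt_trans q18_1.
- rewrite lnM ?posrE ?expR_gt0 // lnV ?posrE // expRK; lra.
Qed.

(** The step [c'] is chosen between [c + u + ln 2], as the construction of the free tile demands,
    and [c + u + ln 3]. The latter is at most [c + u + 2 * d_star] because [1 + rmin <= 2], and it
    keeps the discarded proportion [expR (- (n + 1) * c')] at least [om]. *)
Lemma rational_dim_le : exists c0, forall c, c0 < c ->
  (hausdorff_dim (Bad r (expR (- c))) <=
    (n%:R -
       `|ln (1 - 8^-1 * 3 `^ (- (n.+1%:R * (1 + rmin r))) *
                   expR (- (n.+1%:R * (c + u_const r c))))| /
       ((1 + rmax r) * (c + u_const r c + 2 * d_star r)))%:E)%E.
Proof.
have [b [a [b0 ab]]] := common_denominator r_gt0 r_rat.
have ds0 : 0 < d_star r by exact: d_star_gt0.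
have b0' : 0 < b%:R :> R by rewrite ltr0n.
have l2 : 0 < ln 2 :> R by rewrite ln_gt0 // ltr1n.
have l32 : 0 < ln 3 - ln 2 :> R by rewrite subr_gt0 ltr_ln ?posrE // ltr_nat.
have [C1 HC1] := log_scale b0' l32; have [C2 HC2] := log_scale b0' l2.
exists (`|C1| + `|C2| + 2 * ln 2) => c cgt.
have cC1 : C1 < c by have := ler_norm C1; have := normr_ge0 C2; lra.
have cC2 : C2 < c - ln 2 by have := ler_norm C2; have := normr_ge0 C1; lra.
have c2 : 2 * ln 2 < c by have := normr_ge0 C2; have := normr_ge0 C1; lra.
have rm0 := rmin_gt0 r_gt0; have rm1 := rmin_le1 r.
have [im imE] := rmin_attained n_ge1 r_gt0 r_sum1.
have rmM : rmin r <= rmax r by rewrite imE; exact: rmax_ge.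
pose g := (rmin r)^-1.
have g1 : 1 <= g by rewrite /g invf_ge1.
have grm : g * rmin r = 1 by rewrite /g mulVf // gt_eqF.
set u := u_const r c.
have uE : u = g * (c + 2 * (1 + rmax r) * ln 2) by [].
have uc : c + 2 * ln 2 <= u.
  have M0 : 0 <= rmax r * ln 2 by rewrite mulr_ge0 ?(ltW l2) // (le_trans (ltW rm0)).
  have : 0 <= c + 2 * (1 + rmax r) * ln 2 by nra.
  by rewrite uE; nra.
have [m m0 /andP[c'1 c'2]] := HC1 (c + u + ln 2) (ltac:(lra)).
have [m' m'0 /andP[w1 w2]] := HC2 (u - ln 2) (ltac:(lra)).
pose c' : R := b%:R * ln m%:R; rewrite -/c' in c'1 c'2.
pose w : R := b%:R * ln m'%:R; rewrite -/w in w1 w2.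
have w_le : w <= u by lra.
(* From [g * (1 + rmax) >= 2] the definition of [u_const] gives [u >= g * c + 4 * ln 2], and
   rounding down to [w] loses at most [ln 2]. *)
have w_ge i : c + c / rmin r + 2 * ln 2 <= (1 + r i) * w.
  have ri := rmin_le r i; rewrite -/g.
  have h : g * c + 4 * ln 2 <= u.
    have : 2 <= g * (1 + rmax r).
      have : g * (1 + rmin r) <= g * (1 + rmax r) by rewrite ler_wpM2l ?lerD2l // (le_trans ler01).
      by rewrite mulrDr grm; lra.
    by rewrite uE; nra.
  have hw : g * c + 2 * ln 2 <= w by lra.
  have h1 : (1 + rmin r) * (g * c + 2 * ln 2) <= (1 + r i) * w.
    apply: ler_pM => //; [lra| |by rewrite lerD2l].
    by have := mulr_ge0 (le_trans ler01 g1) (ltW (lt_trans (mulr_gt0 (ltr0n R 2) l2) c2)); lra.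
  have h2 : c + g * c + 2 * ln 2 <= (1 + rmin r) * (g * c + 2 * ln 2).
    have -> : (1 + rmin r) * (g * c + 2 * ln 2) =
      g * c + (g * rmin r) * c + 2 * ln 2 + rmin r * (2 * ln 2) by ring.
    by rewrite grm; have := mulr_gt0 rm0 l2; nra.
  by rewrite [c / _]mulrC; exact: le_trans h1.
have cge0 : 0 <= c by lra.
have uge : ln 2 <= u by lra.
pose N : R := #|tiles (ratio_bound b a m) (ratio b a m)|%:R.
have NE : N = expR (n.+1%:R * c').
  exact: (card_tiles_expR r_sum1 b0 ab m0 (erefl c')).
set om := 8^-1 * _ * _.
set Y := (1 + rmax r) * _.
have c'0 : 0 < c' by lra.
have omN : om <= N^-1.
  rewrite NE -expRN /om; apply: le_trans (_ : 3 `^ (- (n.+1%:R * (1 + rmin r))) *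
      expR (- (n.+1%:R * (c + u))) <= _).
    rewrite -mulrA ler_piMl ?mulr_ge0 ?powR_ge0 ?expR_ge0 // invf_le1 // ler1n //.
  rewrite /powR gt_eqF // -expRD ler_expR.
  have : n.+1%:R * c' <= n.+1%:R * (c + u + ln 3) by rewrite ler_wpM2l //; lra.
  have : 0 <= n.+1%:R * rmin r * ln 3 by rewrite !mulr_ge0 ?(ltW rm0) // ln_ge0 // ler1n.
  by nra.
have om0 : 0 < om by rewrite !mulr_gt0 ?powR_gt0 ?expR_gt0.
have om2 : om <= 2^-1.
  apply: le_trans omN _; rewrite lef_pV2 ?posrE //; last by rewrite NE expR_gt0.
  rewrite NE -[leLHS]lnK ?posrE // ler_expR.
  apply: le_trans (_ : c' <= _); first lra.
  by rewrite ler_peMl ?ler1n // ltW.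
have om1 : om < 1 by apply: le_lt_trans om2 _; rewrite invf_lt1 // ltr1n.
have omabs : `|ln (1 - om)| = - ln (1 - om) by rewrite ler0_norm // ln_le0 // gerBl ltW.
have lnom : - ln (1 - om) <= ln 2.
  have -> : ln 2 = - ln 2^-1 :> R by rewrite lnV ?posrE // opprK.
  rewrite lerN2 ler_ln ?posrE //; lra.
have N0 : 0 < N by rewrite NE expR_gt0.
have N1 : 1 < N by rewrite NE expR_gt1 mulr_gt0.
have NV : N^-1 < 1 by rewrite invf_lt1.
have lnN : - ln (1 - om) <= - ln (1 - N^-1).
  by rewrite lerN2 ler_ln ?posrE ?subr_gt0 // lerD2l lerN2.
have l3d : ln 3 <= 2 * d_star r.
  have l3 : 0 < ln 3 :> R by rewrite ln_gt0 // ltr1n.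
  rewrite /d_star mulrA ler_pdivlMr ?addr_gt0 // mulrC ler_wpM2r ?(ltW l3) //.
  by rewrite -[2]/(1 + 1) lerD2l.
have M0 : 0 < 1 + rmax r by rewrite addr_gt0 // (lt_le_trans rm0).
have c'Y : c' <= c + u + 2 * d_star r by lra.
have cY : (1 + rmax r) * c' <= Y by rewrite /Y ler_wpM2l // ltW.
have Y0 : 0 < Y by apply: lt_le_trans cY; rewrite mulr_gt0.
have lnom0 : 0 < - ln (1 - om).
  by rewrite oppr_gt0 ln_lt0 // subr_gt0 om1 gtrBl.
set B := n%:R - _.
(* Since [om <= 1/2] the numerator is at most [ln 2], so [B] is nonnegative and [B + e] is an
   admissible positive exponent. *)
have B0 : 0 <= B.
  rewrite /B omabs subr_ge0 ler_pdivrMr //; apply: le_trans lnom _.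
  apply: le_trans (_ : Y <= _); last by rewrite ler_peMl ?ler1n // ltW.
  by apply: le_trans cY; nra.
apply/lee_addgt0Pr => e e0; rewrite -EFinD.
apply: (Bad_dim_le n_ge1 r_gt0 r_sum1 b0 ab m0 m'0 (erefl c') (erefl w) cge0 w_le c'1 uge w_ge).
  by rewrite ltr_wpDl.
rewrite -/N; apply: lt_le_trans lnN.
have [ns|ns] := leP (n%:R - (B + e)) 0.
  by apply: le_lt_trans lnom0; rewrite mulr_le0_ge0 // mulr_ge0 // ltW.
apply: le_lt_trans (_ : (n%:R - (B + e)) * Y < _).
  by rewrite ler_wpM2l // ltW.
by rewrite -ltr_pdivlMr // -omabs /B; lra.
Qed.

End RationalWeights.

Theorem theorem3p1 (R : realType) (n : nat) (r : 'I_n -> R)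
    (n_ge1 : (1 <= n)%N) (r_gt0 : forall i, 0 < r i)
    (r_sum1 : \sum_(i < n) r i = 1) :
  (forall (mu : {measure set (borelRn R n) -> \bar R})
          (tau c1 c2 cd delta : R),
     let X := measure_support mu in
     locally_finite mu ->
     X !=set0 ->
     0 < tau -> 0 < c1 -> c1 <= c2 -> power_law r mu X tau c1 c2 ->
     0 < cd -> 0 < delta ->
     abs_decaying r mu X (@affine_hyperplanes R n) cd delta ->
     forall c : R, ln cd / delta + 2 * d_star r < c ->
       (lower_pointwise_dim mu X -
          ((ln 2 + 2 * ln (c2 / c1) + 2 * tau * d_star r +
            `|ln (1 - cd * expR (2 * delta * d_star r) *
                        expR (- (delta * c)))|) /
           ((1 + rmin r) * c))%:E <=
        hausdorff_dim
          (Bad r (2^-1 * expR (- (2 * c + l_star r))) `&` X))%E)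
  /\
  ((forall i, exists q : rat, r i = ratr q) ->
   forall cn : R, 0 < cn ->
     abs_decaying r (@lebesgueRn R n) [set: 'rV[R]_n]
       (@affine_hyperplanes R n) cn (1 + rmin r) ->
   exists c0 : R, 0 < c0 /\
     forall c : R, c0 < c ->
       ((n%:R - `|ln (1 - 18 * cn * expR (- ((1 + rmin r) * c)))| /
                ((1 + rmin r) * c))%:E <=
        hausdorff_dim
          (Bad r (2^-1 * expR (- (2 * c + l_star r + d_star r)))))%E
       /\
       (hausdorff_dim (Bad r (expR (- c))) <=
        (n%:R -
           `|ln (1 - 8^-1 * 3 `^ (- (n.+1%:R * (1 + rmin r))) *
                       expR (- (n.+1%:R * (c + u_const r c))))| /
           ((1 + rmax r) * (c + u_const r c + 2 * d_star r)))%:E)%E).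
Proof.
split.
  move=> mu tau c1 c2 cd delta X _ X0 tau0 c10 c12 pl cd0 de0 dec c cgt.
  (* The bound proved there subtracts no [ln 2], so it is at least the one claimed. *)
  apply: le_trans (power_law_dim_ge n_ge1 r_gt0 r_sum1 X0 tau0 c10 c12 pl cd0 de0 dec cgt).
  have cd1 : 1 <= cd by exact: (decay_ge1 n_ge1 X0 c10 pl dec).
  have ds0 : 0 < d_star r by exact: d_star_gt0.
  have lncd : 0 <= ln cd / delta by rewrite divr_ge0 ?ln_ge0 // ltW.
  have kap0 : 0 < (1 + rmin r) * c.
    by rewrite mulr_gt0 ?addr_gt0 ?rmin_gt0 //; lra.
  apply: leeD2l; rewrite -!EFinN lee_fin lerN2 ler_wpM2r ?invr_ge0 ?(ltW kap0) //.
  have : 0 <= ln 2 :> R by rewrite ln_ge0 // ler1n.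
  lra.
move=> r_rat cn cn0 dec.
have [C1 H1] := rational_dim_ge n_ge1 r_gt0 r_sum1 r_rat cn0 dec.
have [C2 H2] := rational_dim_le n_ge1 r_gt0 r_sum1 r_rat.
exists (`|C1| + `|C2| + 1); split.
  by have := normr_ge0 C1; have := normr_ge0 C2; lra.
move=> c cgt; split.
  by apply: H1; have := ler_norm C1; have := normr_ge0 C2; lra.
by apply: H2; have := ler_norm C2; have := normr_ge0 C1; lra.
Qed.
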